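(* Let the ground ring be $\mathbb{Z}_2$ and let $X$ be a simplicial set. Let $i,j\ge 0$, let $c\in C^j(X;\mathbb{Z}_2)$ and let $x\in C_{i+j}^{N}(X)$ be the class of an $(i+j)$-simplex of $X$. Put $n=j-i$ and $m=i+j$. Then the operation $Sq^i:H^j(X;\mathbb{Z}_2)\to H^{j+i}(X;\mathbb{Z}_2)$ is given on cochains by the following formulae. If $i\le j$ and $i+j$ is even, then $$Sq^i(c)(x)=\sum_{i_n=S(n)}^{m}\ \sum_{i_{n-1}=S(n-1)}^{i_n-1}\cdots\sum_{i_1=S(1)}^{i_2-1}\mu\big(\langle c,\partial_{i_0+1}\cdots\partial_{i_1-1}\,\partial_{i_2+1}\cdots\cdots\partial_{i_{n-1}-1}\,\partial_{i_n+1}\cdots\partial_m x\rangle\otimes\langle c,\partial_0\cdots\partial_{i_0-1}\,\partial_{i_1+1}\cdots\cdots\partial_{i_{n-2}-1}\,\partial_{i_{n-1}+1}\cdots\partial_{i_n-1}x\rangle\big).$$ If $i\le j$ and $i+j$ is odd, then $$Sq^i(c)(x)=\sum_{i_n=S(n)}^{m}\ \sum_{i_{n-1}=S(n-1)}^{i_n-1}\cdots\sum_{i_1=S(1)}^{i_2-1}\mu\big(\langle c,\partial_{i_0+1}\cdots\partial_{i_1-1}\,\partial_{i_2+1}\cdots\cdots\partial_{i_{n-2}-1}\,\partial_{i_{n-1}+1}\cdots\partial_{i_n-1}x\rangle\otimes\langle c,\partial_0\cdots\partial_{i_0-1}\,\partial_{i_1+1}\cdots\cdots\partial_{i_{n-1}-1}\,\partial_{i_n+1}\cdots\partial_m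 x\rangle\big).$$ If $i>j$, then $Sq^i(c)(x)=0$. In these formulae, for $0\le k\le n$, $$S(k)=i_{k+1}-i_{k+2}+\cdots+(-1)^{k+n-1}i_n+(-1)^{k+n}\Big\lfloor\frac{m+1}{2}\Big\rfloor+\Big\lfloor\frac k2\Big\rfloor,$$ and $i_0=S(0)$. (When $n=0$ there is no summation: the formula consists of the single summand with $i_0=S(0)=m/2$.)
   Context: For a simplicial set $X$ with face operators $\partial_i$ and degeneracy operators $s_i$, $C_*^{N}(X)$ is the normalized chain complex over $\mathbb{Z}_2$ (free module on simplices modulo degenerate simplices, differential $\sum_i(-1)^i\partial_i$), $C^j(X;\mathbb{Z}_2)=\mathrm{Hom}(C_j^{N}(X),\mathbb{Z}_2)$, $\langle c,x\rangle=c(x)$ (zero if degrees differ), and $\mu$ is the map induced by multiplication in $\mathbb{Z}_2$. Operators compose from right to left. $Sq^i$ is defined at the cochain level by $$Sq^i(c)(x)=\begin{cases}\mu(\langle c\otimes c,\ AW\,(t\,SHI)^{j-i}(x\times x)\rangle),& i\le j,\\ 0,& i>j,\end{cases}$$ for $c\in C^j(X;\mathbb{Z}_2)$ and $x$ an $(i+j)$-simplex (extended linearly to $C_{i+j}^{N}(X)$), and this induces the Steenrod square $Sq^i:H^j(X;\mathbb{Z}_2)\to H^{j+i}(X;\mathbb{Z}_2)$. Here: A $(p,q)$-shuffle $(\alpha,\beta)$ is a partition of $\{0,\dots,p+q-1\}$ into $\alpha_1<\dots<\alpha_p$ and $\beta_1<\dots<\beta_q$. $AW:C_*^{N}(X\times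 X)\to C_*^{N}(X)\otimes C_*^{N}(X)$ is $AW(a_m\times b_m)=\sum_{i=0}^m\partial_{i+1}\cdots\partial_m a_m\otimes\partial_0\cdots\partial_{i-1}b_m$. $SHI:C_*^{N}(X\times X)\to C_{*+1}^{N}(X\times X)$ is $SHI(a_0\times b_0)=0$ and, for $m\ge1$, $$SHI(a_m\times b_m)=\sum(-1)^{\bar m+sig(\alpha,\beta)+1}\ s_{\beta_q+\bar m}\cdots s_{\beta_1+\bar m}s_{\bar m-1}\partial_{m-q+1}\cdots\partial_m a_m\times s_{\alpha_{p+1}+\bar m}\cdots s_{\alpha_1+\bar m}\partial_{\bar m}\cdots\partial_{m-q-1}b_m,$$ with $\bar m=m-p-q$, $sig(\alpha,\beta)=\sum_{i=1}^{p+1}(\alpha_i-(i-1))$, summed over $0\le q\le m-1$, $0\le p\le m-q-1$ and $(p+1,q)$-shuffles $(\alpha,\beta)$. $t(x_1\times x_2)=x_2\times x_1$. Convention on face strings: a block $\partial_r\cdots\partial_s$ is $\partial_r\partial_{r+1}\cdots\partial_s$, empty (identity) if $r>s$. For $n$ even, the first factor of each summand is the composition, in increasing order of index, of all $\partial_k$ with $i_{2l}<k<i_{2l+1}$ for some $0\le l\le n/2-1$ or $i_n<k\le m$; the second uses all $\partial_k$ with $0\le k<i_0$ or $i_{2l-1}<k<i_{2l}$ for some $1\le l\le n/2$. For $n$ odd, the first factor uses all $\partial_k$ with $i_{2l}<k<i_{2l+1}$ for some $0\le l\le (n-1)/2$; the second uses all $\partial_k$ with $0\le k<i_0$, or $i_{2l-1}<k<i_{2l}$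 for some $1\le l\le (n-1)/2$, or $i_n<k\le m$. Sums with lower limit larger than the upper limit are $0$. *)

(* Defs.v *)
From HB Require Import structures.
From mathcomp Require Import all_boot all_order all_algebra.
From mathcomp Require Import boolp.
From mathcomp Require Import freeg.

Set Implicit Arguments.
Unset Strict Implicit.
Unset Printing Implicit Defensive.

Import GRing.Theory.
Local Open Scope ring_scope.
Local Open Scope quotient_scope.

(* Quotient of a module by the submodule spanned by a set of vectors. *)

Definition span (R : comNzRingType) (V : lmodType R) (G : V -> Prop) (v : V) :
    Prop :=
  forall P : V -> Prop, P 0 ->
    (forall (a : R) u w, P u -> P w -> P (a *: u + w)) ->
    (forall g, G g -> P g) -> P v.

Section Quotient.
Context (R : comNzRingType) (V : lmodType R) (G : V -> Prop).

Lemma span0 : span G 0. Proof. by move=> P. Qed.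

Lemma spanP a u w : span G u -> span G w -> span G (a *: u + w).
Proof. by move=> su sw P P0 PD PG; apply: (PD); [apply: su | apply: sw]. Qed.

Lemma spanD u w : span G u -> span G w -> span G (u + w).
Proof. by move=> su sw; rewrite -[u]scale1r; apply: spanP. Qed.

Lemma spanZ a u : span G u -> span G (a *: u).
Proof. by move=> su; rewrite -[_ *: _]addr0; apply: spanP => //; apply: span0. Qed.

Lemma spanN u : span G u -> span G (- u).
Proof. by rewrite -scaleN1r; apply: spanZ. Qed.

Definition spaneq : rel V := [rel u v | `[< span G (u - v) >]].

Fact spaneq_refl : reflexive spaneq.
Proof. by move=> u; apply/asboolP; rewrite subrr; apply: span0. Qed.

Fact spaneq_sym : symmetric spaneq.
Proof.
by move=> u v; apply/asboolP/asboolP => /spanN; rewrite opprB.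
Qed.

Fact spaneq_trans : transitive spaneq.
Proof.
move=> v u w /asboolP uv /asboolP vw; apply/asboolP.
by rewrite -(subrKA v); apply: spanD.
Qed.

Canonical spaneq_equiv := EquivRel spaneq spaneq_refl spaneq_sym spaneq_trans.

Definition lquot := {eq_quot spaneq}.

HB.instance Definition _ := Choice.on lquot.
HB.instance Definition _ := EqQuotient.on lquot.

Lemma lquotE u v : \pi_lquot u = \pi_lquot v <-> span G (u - v).
Proof. by split=> [/eqmodP/asboolP|uv]; last by apply/eqmodP/asboolP. Qed.

Lemma span_repr u : span G (repr (\pi_lquot u) - u).
Proof. by apply/lquotE; rewrite reprK. Qed.

Definition lquot_add (x y : lquot) : lquot := \pi_lquot (repr x + repr y).
Definition lquot_opp (x : lquot) : lquot := \pi_lquot (- repr x).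
Definition lquot_scale (a : R) (x : lquot) : lquot := \pi_lquot (a *: repr x).

Lemma lquot_addE u v : lquot_add (\pi_lquot u) (\pi_lquot v) = \pi_lquot (u + v).
Proof.
by apply/lquotE; rewrite opprD addrACA; apply: spanD; apply: span_repr.
Qed.

Lemma lquot_oppE u : lquot_opp (\pi_lquot u) = \pi_lquot (- u).
Proof. by apply/lquotE; rewrite -opprD; apply: spanN; apply: span_repr. Qed.

Lemma lquot_scaleE a u : lquot_scale a (\pi_lquot u) = \pi_lquot (a *: u).
Proof. by apply/lquotE; rewrite -scalerBr; apply: spanZ; apply: span_repr. Qed.

Fact lquot_addA : associative lquot_add.
Proof.
elim/quotW=> u; elim/quotW=> v; elim/quotW=> w.
by rewrite (lquot_addE v w) (lquot_addE u v) !lquot_addE addrA.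
Qed.

Fact lquot_addC : commutative lquot_add.
Proof. by elim/quotW=> u; elim/quotW=> v; rewrite !lquot_addE addrC. Qed.

Fact lquot_add0 : left_id (\pi_lquot 0) lquot_add.
Proof. by elim/quotW=> u; rewrite lquot_addE add0r. Qed.

Fact lquot_addN : left_inverse (\pi_lquot 0) lquot_opp lquot_add.
Proof. by elim/quotW=> u; rewrite lquot_oppE (lquot_addE (- u)) addNr. Qed.

HB.instance Definition _ :=
  GRing.isZmodule.Build lquot lquot_addA lquot_addC lquot_add0 lquot_addN.

Fact lquot_scaleA a b x :
  lquot_scale a (lquot_scale b x) = lquot_scale (a * b) x.
Proof. by elim/quotW: x => u; rewrite (lquot_scaleE b) !lquot_scaleE scalerA. Qed.

Fact lquot_scale1 : left_id 1 lquot_scale.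
Proof. by elim/quotW=> u; rewrite lquot_scaleE scale1r. Qed.

Fact lquot_scaleDr : right_distributive lquot_scale +%R.
Proof.
move=> a; elim/quotW=> u; elim/quotW=> v.
rewrite [X in lquot_scale a X]lquot_addE !lquot_scaleE scalerDr.
by rewrite [RHS]lquot_addE.
Qed.

Fact lquot_scaleDl x : {morph lquot_scale^~ x : a b / a + b}.
Proof.
by elim/quotW: x => u a b; rewrite !lquot_scaleE scalerDl [RHS]lquot_addE.
Qed.

HB.instance Definition _ := GRing.Zmodule_isLmodule.Build R lquot
  lquot_scaleA lquot_scale1 lquot_scaleDr lquot_scaleDl.

End Quotient.

(* The map on a quotient of a free module given by a formula on generators,
   evaluated on a chosen representative. Every formula it is applied to below
   respects the relations, so that the choice is immaterial. *)
Definition lift_gen (R : comNzRingType) (T : choiceType) (W : lmodType R)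
    (G : {freeg T / R} -> Prop) (f : T -> W) (z : lquot G) : W :=
  fglift f (repr z).

Inductive tensor_rel (R : comNzRingType) (M N : lmodType R) :
    {freeg (M * N)%type / R} -> Prop :=
| TensorAddl u u' v :
    tensor_rel (<< (u + u', v) >> - << (u, v) >> - << (u', v) >>)
| TensorAddr u v v' :
    tensor_rel (<< (u, v + v') >> - << (u, v) >> - << (u, v') >>)
| TensorScalel a u v : tensor_rel (<< (a *: u, v) >> - a *: << (u, v) >>)
| TensorScaler a u v : tensor_rel (<< (u, a *: v) >> - a *: << (u, v) >>).

Definition tensor (R : comNzRingType) (M N : lmodType R) : lmodType R :=
  lquot (@tensor_rel R M N).

Definition tens (R : comNzRingType) (M N : lmodType R) (u : M) (v : N) :
    tensor M N :=
  \pi_(lquot (@tensor_rel R M N)) << (u, v) >>.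

Definition tensor_map (R : comNzRingType) (M N M' N' : lmodType R)
    (f : M -> M') (g : N -> N') : tensor M N -> tensor M' N' :=
  lift_gen (fun w : (M * N)%type => tens (f w.1) (g w.2)).

Definition mu : tensor ('F_2)^o ('F_2)^o -> 'F_2 :=
  lift_gen (fun w : (('F_2)^o * ('F_2)^o)%type => w.1 * w.2 : ('F_2)^o).

(* Faces and degeneracies are indexed by nat; the values of [face n i] for
   [i > n.+1] and of [degen n i] for [i > n] are never used. *)
Record sset := SSet {
  simp : nat -> Type;
  face : forall n, nat -> simp n.+1 -> simp n;
  degen : forall n, nat -> simp n -> simp n.+1;
  face_face : forall n i j (x : simp n.+2), (i < j <= n.+2)%N ->
    face i (face j x) = face j.-1 (face i x);
  degen_degen : forall n i j (x : simp n), (i <= j <= n)%N ->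
    degen i (degen j x) = degen j.+1 (degen i x);
  face_degen_lt : forall n i j (x : simp n.+1), (i < j <= n.+1)%N ->
    face i (degen j x) = degen j.-1 (face i x);
  face_degen_id : forall n i j (x : simp n), (j <= n)%N ->
    i = j \/ i = j.+1 -> face i (degen j x) = x;
  face_degen_gt : forall n i j (x : simp n.+1),
    (j <= n.+1)%N -> (j.+1 < i <= n.+2)%N ->
    face i (degen j x) = degen j (face i.-1 x)
}.
Arguments face [s n] i x.
Arguments degen [s n] i x.

Section Product.
Context (X Y : sset).

Let simpXY n : Type := (simp X n * simp Y n)%type.
Let faceXY n i (x : simpXY n.+1) : simpXY n := (face i x.1, face i x.2).
Let degenXY n i (x : simpXY n) : simpXY n.+1 := (degen i x.1, degen i x.2).

Fact prod_face_face n i j (x : simpXY n.+2) : (i < j <= n.+2)%N ->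
  faceXY i (faceXY j x) = faceXY j.-1 (faceXY i x).
Proof. by move=> ij; congr (_, _); apply: face_face. Qed.

Fact prod_degen_degen n i j (x : simpXY n) : (i <= j <= n)%N ->
  degenXY i (degenXY j x) = degenXY j.+1 (degenXY i x).
Proof. by move=> ij; congr (_, _); apply: degen_degen. Qed.

Fact prod_face_degen_lt n i j (x : simpXY n.+1) : (i < j <= n.+1)%N ->
  faceXY i (degenXY j x) = degenXY j.-1 (faceXY i x).
Proof. by move=> ij; congr (_, _); apply: face_degen_lt. Qed.

Fact prod_face_degen_id n i j (x : simpXY n) : (j <= n)%N ->
  i = j \/ i = j.+1 -> faceXY i (degenXY j x) = x.
Proof.
by case: x => x y jn ij; congr (_, _); apply: face_degen_id.
Qed.

Fact prod_face_degen_gt n i j (x : simpXY n.+1) :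
  (j <= n.+1)%N -> (j.+1 < i <= n.+2)%N ->
  faceXY i (degenXY j x) = degenXY j (faceXY i.-1 x).
Proof. by move=> jn ij; congr (_, _); apply: face_degen_gt. Qed.

Definition sprod : sset := SSet prod_face_face prod_degen_degen
  prod_face_degen_lt prod_face_degen_id prod_face_degen_gt.

End Product.

(* Simplices of unspecified dimension: strings of operators then compose
   without transport between provably equal dimensions. *)
Definition simplex (X : sset) : Type := {n : nat & simp X n}.

(* The value on a 0-simplex is never used. *)
Definition dface (X : sset) (k : nat) (y : simplex X) : simplex X :=
  match y with
  | existT n.+1 x => Tagged (simp X) (face k x)
  | existT 0 _ => y
  end.

Definition ddegen (X : sset) (k : nat) (y : simplex X) : simplex X :=
  Tagged (simp X) (degen k (tagged y)).

(* [faces [:: k_1; ..; k_r] y] is d_{k_1} .. d_{k_r} y, the last index acting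
   first, and likewise for [degens]. *)
Definition faces (X : sset) (ks : seq nat) (y : simplex X) : simplex X :=
  foldr (@dface X) y ks.

Definition degens (X : sset) (ks : seq nat) (y : simplex X) : simplex X :=
  foldr (@ddegen X) y ks.

Definition degenerate (X : sset) (n : nat) (x : simp X n) : Prop :=
  exists k i (y : simp X k),
    (i <= k)%N /\ Tagged (simp X) x = Tagged (simp X) (degen i y).

Inductive degenerate_chain (X : sset) (n : nat) :
    {freeg {classic simp X n} / 'F_2} -> Prop :=
| DegenerateChain (x : simp X n) of degenerate x :
    degenerate_chain << (x : {classic simp X n}) >>.

(* The module C^N_n(X). *)
Definition nchain (X : sset) (n : nat) : lmodType 'F_2 :=
  lquot (@degenerate_chain X n).

Definition cls (X : sset) (n : nat) (x : simp X n) : nchain X n :=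
  \pi_(lquot (@degenerate_chain X n)) << (x : {classic simp X n}) >>.

(* The class in degree n of a simplex y; the default value 0, for y not of
   dimension n, does not occur in the formulae for AW and SHI. *)
Definition cls_in (X : sset) (n : nat) (y : simplex X) : nchain X n :=
  untag 0 (@cls X n) y.

Definition cross_in (X Y : sset) (n : nat) (a : simplex X) (b : simplex Y) :
    nchain (sprod X Y) n :=
  untag 0 (fun x : simp X n =>
    untag 0 (fun y : simp Y n => @cls (sprod X Y) n (x, y)) b) a.

(* The (p, q)-shuffles, given by the set of the alpha_i; [enum] lists the
   elements of a set of ordinals in increasing order. *)
Definition shuffle (p q : nat) : pred {set 'I_(p + q)} :=
  fun A => #|A| == p.

Definition shuffle_alpha (n : nat) (A : {set 'I_n}) : seq nat :=
  [seq val k | k <- enum A].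

Definition shuffle_beta (n : nat) (A : {set 'I_n}) : seq nat :=
  [seq val k | k <- enum (~: A)].

Definition shuffle_sig (n : nat) (A : {set 'I_n}) : nat :=
  (\sum_(i < #|A|) (nth 0 (shuffle_alpha A) i - i))%N.

Definition SHI_simplex (X : sset) (m : nat) (a b : simp X m) :
    nchain (sprod X X) m.+1 :=
  \sum_(q < m) \sum_(p < m - q) \sum_(A | @shuffle p.+1 q A)
    let mb := (m - p - q)%N in
    (-1) ^+ (mb + shuffle_sig A + 1) *:
    cross_in m.+1
      (degens [seq (k + mb)%N | k <- rev (shuffle_beta A)]
        (ddegen mb.-1
          (faces (index_iota (m - q).+1 m.+1) (Tagged (simp X) a))))
      (degens [seq (k + mb)%N | k <- rev (shuffle_alpha A)]
        (faces (index_iota mb (m - q)) (Tagged (simp X) b))).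

Definition SHI (X : sset) (m : nat) :
    nchain (sprod X X) m -> nchain (sprod X X) m.+1 :=
  lift_gen (fun w : {classic simp (sprod X X) m} => SHI_simplex w.1 w.2).

Definition swap (X : sset) (m : nat) :
    nchain (sprod X X) m -> nchain (sprod X X) m :=
  lift_gen (fun w : {classic simp (sprod X X) m} =>
    @cls (sprod X X) m (w.2, w.1)).

Fixpoint swapSHI (X : sset) (k m : nat) (z : nchain (sprod X X) m) :
    nchain (sprod X X) (k + m) :=
  if k is k'.+1 then swap (SHI (swapSHI k' z)) else z.

(* An element of (C^N(X) (x) C^N(X))_m, the direct sum over p <= m of the
   C^N_p(X) (x) C^N_{m-p}(X), is the family of its components. *)
Definition nchain2 (X : sset) (m : nat) : Type :=
  forall p : 'I_m.+1, tensor (nchain X p) (nchain X (m - p)).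

(* The i-th term of the sum defining AW is the component of index p = i. *)
Definition AW (X : sset) (m : nat) (z : nchain (sprod X X) m) : nchain2 X m :=
  fun p => lift_gen (fun w : {classic simp (sprod X X) m} =>
    tens (cls_in p (faces (index_iota p.+1 m.+1) (Tagged (simp X) w.1)))
         (cls_in (m - p) (faces (index_iota 0 p) (Tagged (simp X) w.2)))) z.

(* C^j(X; Z_2) *)
Definition cochain (X : sset) (j : nat) : Type := {scalar nchain X j}.

Definition pairing (X : sset) (j : nat) (c : cochain X j) (k : nat)
    (x : nchain X k) : ('F_2)^o :=
  if k =P j is ReflectT e then c (ecast k (nchain X k) e x) else 0.

(* <c (x) c, z> *)
Definition pairing2 (X : sset) (j : nat) (c : cochain X j) (m : nat)
    (z : nchain2 X m) : tensor ('F_2)^o ('F_2)^o :=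
  \sum_(p < m.+1) tensor_map (@pairing X j c p) (@pairing X j c (m - p)) (z p).

Definition Sq (X : sset) (i j : nat) (c : cochain X j) :
    nchain X (i + j) -> 'F_2 :=
  if (i <= j)%N then
    lift_gen (fun x : {classic simp X (i + j)} =>
      mu (pairing2 c (AW (swapSHI (j - i) (@cls (sprod X X) _ (x, x)))))
        : ('F_2)^o)
  else fun=> 0.

(* [pair_faces c ks y] is <c, d_{k_1} .. d_{k_r} y>, zero if the dimension of
   that face is not j. *)
Definition pair_faces (X : sset) (j : nat) (c : cochain X j) (ks : seq nat)
    (y : simplex X) : ('F_2)^o :=
  pairing c (cls (tagged (faces ks y))).

(* Lists [t] below hold i_{k+1}, .., i_n, so that n - k is their length and
   (-1)^(k+n) = (-1)^(n-k). *)
Definition S_bound (m k : nat) (t : seq int) : int :=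
  \sum_(r < size t) (-1) ^+ r * t`_r
  + (-1) ^+ size t * ((m.+1)./2)%:Z + (k./2)%:Z.

(* The integers from a to b, none if a > b. *)
Definition int_range (a b : int) : seq int :=
  if a <= b then [seq a + r%:Z | r <- iota 0 `|b - a|%N.+1] else [::].

(* The sum over i_k, .., i_1 of F [:: i_0; i_1; ..; i_n] when [t] holds
   i_{k+1}, .., i_n; the upper limit of i_k is i_{k+1} - 1, or m if k = n. *)
Fixpoint nested_sum (m k : nat) (t : seq int) (F : seq int -> 'F_2) : 'F_2 :=
  if k is k'.+1 then
    \sum_(v <- int_range (S_bound m k t) (head m.+1%:Z t - 1))
       nested_sum m k' (v :: t) F
  else F (S_bound m 0 t :: t).

Section FaceStrings.
Context (m n : nat) (I : seq int).

Definition between (a b : nat) (k : nat) : bool :=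
  (I`_a < k%:Z) && (k%:Z < I`_b).

Definition even_fst : seq nat :=
  [seq k <- iota 0 m.+1 |
    has (fun l => between l.*2 l.*2.+1 k) (iota 0 n./2) || (I`_n < k%:Z)].

Definition even_snd : seq nat :=
  [seq k <- iota 0 m.+1 |
    (k%:Z < I`_0) || has (fun l => between l.*2.-1 l.*2 k) (iota 1 n./2)].

Definition odd_fst : seq nat :=
  [seq k <- iota 0 m.+1 |
    has (fun l => between l.*2 l.*2.+1 k) (iota 0 (n.-1)./2.+1)].

Definition odd_snd : seq nat :=
  [seq k <- iota 0 m.+1 |
    [|| k%:Z < I`_0,
        has (fun l => between l.*2.-1 l.*2 k) (iota 1 (n.-1)./2)
      | I`_n < k%:Z]].

End FaceStrings.

(* Main.v *)
Require Import Defs.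
From HB Require Import structures.
From mathcomp Require Import all_boot all_order all_algebra.
From mathcomp Require Import zify.
From mathcomp Require Import boolp freeg.

Set Implicit Arguments.
Unset Strict Implicit.
Unset Printing Implicit Defensive.

Import GRing.Theory.
Local Open Scope ring_scope.
Local Open Scope quotient_scope.

(** Evaluated on c (x) c, the chain AW (t SHI)^n (x * x) is a scalar, and the
    idea is to compute this scalar by letting the operators act on the
    functional c (x) c instead, one factor t SHI at a time.

    Cut points u_0 < .. < u_n in {0, .., d} divide [0, d] into the closed
    intervals [0, u_0], [u_0, u_1], .., [u_n, d], neighbours sharing an
    endpoint. Taking every other interval gives two sets of vertices:
    [blocks true] contains the last interval and [blocks false] the one before
    it. The function [cup n a b] sums, over all choices of n + 1 cut points,
    the product of the values of c on the face of a spanned by [blocks false]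
    and on the face of b spanned by [blocks true]. For n = 0 this is
    Alexander-Whitney followed by c (x) c ([mu_pairing2_AW]).

    The heart of the proof is that composing [cup n] with t SHI gives
    [cup n.+1] ([cup_chain_swap_SHI]). In terms of vertices, a summand of
    SHI (a * b) with a and b of dimension d is a lattice path: it follows the
    diagonal up to (r, r), jumps to (r, s) for some r < s, and reaches (s, d)
    by unit steps in one coordinate at a time. A face with a repeated vertex is
    degenerate, so c vanishes on it. Let u be the largest cut point. Along the
    last interval [u, d + 1] the first coordinate must increase at each step,
    which excludes the jump and leaves horizontal steps only. Along the interval
    before it the second coordinate must increase, so that after the jump only
    vertical steps remain. The ends of this interval that are cut points are
    vertices of the other face as well; the first coordinate must therefore
    differ at them, so the lower one lies below r. Hence, for each r < s, only
    the path that goes up first and then to the right contributes, u is the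
    index of its corner, and the other cut points lie below r ([stair_forced]).
    The two faces it produces are those of the cut points in which u has been
    replaced by r and s ([stair_value]), so the surviving terms are exactly the
    terms of [cup n.+1]. Iterating, Sq^i c (x) = [cup (j - i)] x x ([Sq_cup]).

    It remains to recognize the nested sum. A summand of [cup] is zero unless
    both faces have dimension j; this equates an alternating sum of the cut
    points with a constant, so i_0 is determined by i_1, .., i_n, and it forces
    the inequalities i_k >= S(k) ([nested_sumE]). The strings of faces are read
    off from the parity of the number of cut points below a vertex
    ([mem_blocks]). *)

(** * Alternating intervals and sums over cut points *)

(** The cut points are listed in decreasing order because the inductive step
    of the proof changes them only at the upper end. *)
Fixpoint blocks (last : bool) (d : nat) (us : seq nat) : seq nat :=
  if us is u :: us' then
    if last then blocks false u us' ++ iota u (d.+1 - u) else blocks true u us'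
  else if last then iota 0 d.+1 else [::].

Lemma blocks_false d d' us : blocks false d us = blocks false d' us.
Proof. by case: us. Qed.

Lemma path_gtn_widen u v us : (u <= v)%N -> path gtn u us -> path gtn v us.
Proof. by case: us => //= w us uv /andP[wu ->]; rewrite andbT; lia. Qed.

Lemma count_lt_top u us k : (u <= k)%N -> path gtn u us ->
  count (fun x => x < k)%N us = size us.
Proof.
move=> uk; elim: us u uk => //= v us IH u uk /andP[/= vu p].
by rewrite (IH v) //; lia.
Qed.

Lemma notin_top u us k : (u <= k)%N -> path gtn u us -> k \notin us.
Proof.
move=> uk; elim: us u uk => //= v us IH u uk /andP[/= vu p].
by rewrite inE negb_or (IH v) ?andbT //; lia.
Qed.

(** The parity of the number of cut points below k tells in which interval k
    lies; a cut point belongs to two neighbouring intervals, hence to both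
    blocks. *)
Lemma mem_blocks b d us k : path gtn d.+1 us ->
  (k \in blocks b d us) = (k <= d)%N &&
    ((k \in us) || (b == (odd (count (fun x => x < k)%N us) == odd (size us)))).
Proof.
elim: us b d => [|u us IH] b d /=.
  case: b => _; last by rewrite andbF.
  by rewrite -[_ :: _]/(iota 0 d.+1) mem_iota andbT.
case/andP=> ud p; rewrite inE.
have p' : path gtn u.+1 us by exact: path_gtn_widen (leqnSn _) p.
case: (ltngtP k u) => ku.
- rewrite /=; case: b; rewrite ?mem_cat ?mem_iota IH //=.
    lia.
  lia.
- have ku' : (u <= k)%N by lia.
  rewrite (count_lt_top ku') // (negbTE (notin_top ku' p)) /=.
  by case: b; rewrite ?mem_cat ?mem_iota IH //; lia.
- subst k; have c := count_lt_top (leqnn u) p.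
  rewrite orTb andbT.
  case: b; rewrite ?mem_cat ?mem_iota IH // c.
    lia.
  by rewrite leqnn eqxx; lia.
Qed.

Lemma blocks_bound b d us : path gtn d.+1 us -> all (leq^~ d) (blocks b d us).
Proof. by move=> p; apply/allP=> k; rewrite mem_blocks // => /andP[]. Qed.

(** The intervals cover [0, d] edge by edge, since neighbours overlap. *)
Lemma blocks_step d us k : (k < d)%N -> path gtn d.+1 us ->
  exists b, (k \in blocks b d us) && (k.+1 \in blocks b d us).
Proof.
elim: us d => [|u us IH] d kd.
  by exists true; rewrite !mem_iota; lia.
case/andP=> /= ud p; case: (leqP u k) => uk.
  by exists true; rewrite !mem_cat !mem_iota; lia.
have [|b /andP[h1 h2]] := IH u uk.
  exact: path_gtn_widen (leqnSn _) p.
by exists (~~ b); case: b h1 h2 => /=; rewrite ?mem_cat => -> ->.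
Qed.

Lemma head_blocks_false u v us : path gtn v us ->
  v \in blocks false u (v :: us).
Proof.
move=> p; rewrite [blocks _ _ _]/= mem_blocks ?(path_gtn_widen _ p) //.
by rewrite (count_lt_top _ p) ?leqnn ?eqxx ?orbT.
Qed.

Section DecreasingSums.
Context (V : nmodType).

Fixpoint sum_decr (k top : nat) (F : seq nat -> V) : V :=
  if k is k'.+1 then
    \sum_(u < top) sum_decr k' u (fun us => F ((u : nat) :: us))
  else F [::].

Lemma sum_decrS k top F :
  sum_decr k.+1 top F =
  \sum_(u < top) sum_decr k u (fun us => F ((u : nat) :: us)).
Proof. by []. Qed.

Lemma eq_sum_decr k top F F' :
  (forall us, size us = k -> path gtn top us -> F us = F' us) ->
  sum_decr k top F = sum_decr k top F'.
Proof.
elim: k top F F' => [|k IH] top F F' eqF /=; first exact: eqF.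
apply: eq_bigr => u _; apply: IH => us su p.
by apply: eqF; rewrite /= ?su ?ltn_ord.
Qed.

Lemma sum_decr0 k top F :
  (forall us, size us = k -> path gtn top us -> F us = 0) ->
  sum_decr k top F = 0.
Proof.
move=> F0; rewrite (eq_sum_decr (F' := fun=> 0)) // => {F F0}.
by elim: k top => //= k IH top; apply: big1.
Qed.

Lemma sum_ord_narrow (r u : nat) (f : nat -> V) : (r <= u)%N ->
  (forall v, (r <= v < u)%N -> f v = 0) -> \sum_(v < u) f v = \sum_(v < r) f v.
Proof.
move=> ru f0; rewrite -!(big_mkord xpredT) (big_cat_nat (n := r)) //=.
by rewrite [X in _ + X = _]big_nat [X in _ + X = _]big1 ?addr0.
Qed.

Lemma sum_decr_narrow k r u F : (r <= u)%N ->
  (forall us, size us = k -> path gtn u us -> ~~ path gtn r us -> F us = 0) ->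
  sum_decr k u F = sum_decr k r F.
Proof.
case: k => [|k] //= ru F0.
pose f v := sum_decr k v (fun us => F (v :: us)).
apply: (sum_ord_narrow (f := f)) => //.
move=> v /andP[rv vu]; apply: sum_decr0 => us su p.
by apply: F0; rewrite /= ?su ?vu //= negb_and -leqNgt rv.
Qed.

End DecreasingSums.

(** * Lattice paths *)

Lemma sorted_map_iota (f : nat -> nat) u n t :
  sorted ltn (map f (iota u n)) -> (u <= t)%N -> (t.+1 < u + n)%N ->
  (f t < f t.+1)%N.
Proof.
elim: n u => [|n IH] u; first by lia.
case: n IH => [|n] IH /=; first by lia.
case/andP=> fu s; rewrite leq_eqVlt => /orP[/eqP <- //|ut tn].
by apply: (IH u.+1) => //; lia.
Qed.

Lemma sorted_cat_lt (s1 s2 : seq nat) x y :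
  sorted ltn (s1 ++ s2) -> x \in s1 -> y \in s2 -> (x < y)%N.
Proof.
rewrite (sorted_pairwise ltn_trans) pairwise_cat => /andP[/allrelP h _].
exact: h.
Qed.

Lemma level_run (h : nat -> nat) a b : (a <= b)%N ->
  (forall t, a <= t < b -> h t.+1 = h t)%N -> h b = h a.
Proof.
elim: b => [|b IH]; first by rewrite leqn0 => /eqP->.
rewrite leq_eqVlt => /orP[/eqP-> //|ab H].
have Hb : h b.+1 = h b by apply: H; lia.
by rewrite Hb IH // => t tb; apply: H; lia.
Qed.

Lemma slope_run (h : nat -> nat) a b : (a <= b)%N ->
  (forall t, a <= t < b -> h t.+1 = (h t).+1)%N -> h b = (h a + (b - a))%N.
Proof.
elim: b => [|b IH]; first by rewrite leqn0 => /eqP->; lia.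
rewrite leq_eqVlt => /orP[/eqP-> //|ab H]; first by lia.
have Hb : h b.+1 = (h b).+1 by apply: H; lia.
by rewrite Hb IH => [|//|t tb]; [lia|apply: H; lia].
Qed.

Lemma map_id_upto r (h : nat -> nat) (l : seq nat) :
  (forall t, (t <= r)%N -> h t = t) -> all (leq^~ r) l -> map h l = l.
Proof. by move=> hr /allP l_r; apply: map_id_in => t /l_r; apply: hr. Qed.

Lemma map_iota_shift (h : nat -> nat) a b n :
  (forall t, (t < n)%N -> h (a + t)%N = (b + t)%N) ->
  map h (iota a n) = iota b n.
Proof.
elim: n a b => //= n IH a b H; rewrite -{1}[a]addn0 H // addn0.
congr cons; apply: IH => t tn.
by rewrite !addSnnS H.
Qed.

(** The path t |-> (f t, g t) traced by the vertices of a summand of SHI on a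
    d-simplex: diagonal steps to (r, r), the jump to (r, s), and then unit
    steps in one coordinate to (s, d). *)
Record staircase (r s d : nat) (f g : nat -> nat) : Prop := Staircase {
  stair_diag : forall t, (t <= r)%N -> f t = t /\ g t = t;
  stair_jump : f r.+1 = r /\ g r.+1 = s;
  stair_step : forall t, (r < t <= d)%N ->
    (f t.+1 = (f t).+1 /\ g t.+1 = g t) \/ (f t.+1 = f t /\ g t.+1 = (g t).+1);
  stair_end : f d.+1 = s /\ g d.+1 = d }.

Section Staircase.
Context (r s d : nat) (f g : nat -> nat).
Hypotheses (rs : (r < s)%N) (sd : (s <= d)%N) (st : staircase r s d f g).

(** If neither face degenerates, then u lies beyond the jump (the first
    coordinate does not move there), the path is horizontal from u on, and it
    is vertical between the jump and u (the second coordinate has to move).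
    The corner u is then determined by counting vertical steps. A cut point v
    with r <= v < u would give the same first coordinate at v and at u,
    although both are vertices of the face of the first factor. *)
Lemma stair_forced u us : (u <= d.+1)%N -> path gtn u us ->
  sorted ltn (map g (blocks true u us)) ->
  sorted ltn (map f (blocks false u us ++ iota u (d.+2 - u))) ->
  [/\ u = (r.+1 + (d - s))%N, path gtn r us,
      forall t, (r < t < u)%N -> f t.+1 = f t /\ g t.+1 = (g t).+1
    & forall t, (u <= t <= d)%N -> f t.+1 = (f t).+1 /\ g t.+1 = g t].
Proof.
case: st => diag [fr gr] step [fd gd] ud p sg sf.
have [f0 g0] := diag r (leqnn _).
have fu t : (u <= t <= d)%N -> (f t < f t.+1)%N.
  move=> /andP[ut td]; apply: (@sorted_map_iota _ u (d.+2 - u)); try lia.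
  by move: sf; rewrite map_cat => /cat_sorted2[].
have ru : (r < u)%N.
  rewrite ltnNge; apply/negP=> ur; have := fu r; rewrite fr f0; lia.
have horiz t : (u <= t <= d)%N -> f t.+1 = (f t).+1 /\ g t.+1 = g t.
  by move=> utd; have := fu t utd; case: (step t) => [||[] ]; lia.
have gu : g u = d.
  by rewrite -gd; apply/esym/level_run => // t tb; apply: (horiz t _).2; lia.
(* v is the lower end of the interval that ends at u *)
have vert v : (v <= u)%N ->
    (forall t, (v <= t)%N -> (t < u)%N -> (g t < g t.+1)%N) ->
    forall t, (v <= t)%N -> (r < t < u)%N ->
      f t.+1 = f t /\ g t.+1 = (g t).+1.
  move=> vu gv t vt rtu.
  by have := gv t vt; case: (step t) => [||[] ]; lia.
have conc : (forall t, (r < t < u)%N -> f t.+1 = f t /\ g t.+1 = (g t).+1) ->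
    u = (r.+1 + (d - s))%N.
  move=> V; have := @slope_run g r.+1 u ru.
  by rewrite gu gr => ->; [lia|move=> t tb; apply: (V t _).2; lia].
case: us p sg sf => [|v us] p sg sf.
  have V t : (r < t < u)%N -> f t.+1 = f t /\ g t.+1 = (g t).+1.
    move=> rtu; apply: (vert 0%N) => // t' _ t'u.
    by apply: (sorted_map_iota sg) => //; lia.
  by split=> //; apply: conc.
have vu : (v < u)%N by case/andP: p.
have gv t : (v <= t)%N -> (t < u)%N -> (g t < g t.+1)%N.
  move=> vt tu; apply: (@sorted_map_iota _ v (u.+1 - v)); try lia.
  by move: sg; rewrite [blocks _ _ _]/= map_cat => /cat_sorted2[].
have fvu : (f v < f u)%N.
  apply: (sorted_cat_lt (s1 := map f (blocks false u (v :: us)))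
                        (s2 := map f (iota u (d.+2 - u)))).
  - by rewrite -map_cat.
  - by apply/map_f/head_blocks_false; case/andP: p.
  - by apply: map_f; rewrite mem_iota; lia.
have V := vert v (ltnW vu) gv.
have vr : (v < r)%N.
  rewrite ltnNge; apply/negP=> rv.
  suff E : f v = f u by rewrite E ltnn in fvu.
  case: (ltnP r v) => rv'.
    by apply/esym/level_run => [|t tb]; last apply: (V t _ _).1; lia.
  have -> : v = r by lia.
  rewrite f0 -[in LHS]fr.
  by apply/esym/level_run => [|t tb]; last apply: (V t _ _).1; lia.
split=> //; last by move=> t rtu; apply: V; lia.
- by apply: conc => t rtu; apply: V; lia.
- by case/andP: p => _ p; apply/andP.
Qed.

(** Going up from (r, s) to (r, d) appends [s, d] to an interval ending at r
    in the second coordinate; going right from there runs through [r, s] in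
    the first one. *)
Lemma stair_value u us : path gtn r us -> u = (r.+1 + (d - s))%N ->
  (forall t, (r < t < u)%N -> f t.+1 = f t /\ g t.+1 = (g t).+1) ->
  (forall t, (u <= t <= d)%N -> f t.+1 = (f t).+1 /\ g t.+1 = g t) ->
  map g (blocks true u us) = blocks true r us ++ iota s (d.+1 - s) /\
  map f (blocks false u us ++ iota u (d.+2 - u)) =
    blocks false r us ++ iota r (s.+1 - r).
Proof.
case: st => diag [fr gr] step [fd gd] p uE V H.
have gV t : (r < t <= u)%N -> g t = (s + (t - r.+1))%N.
  move=> rtu; rewrite -gr (@slope_run g r.+1) //; first lia.
  by move=> t' t'b; apply: (V t' _).2; lia.
have fV t : (r < t <= u)%N -> f t = r.
  move=> rtu; rewrite -[RHS]fr (@level_run f r.+1) //; first lia.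
  by move=> t' t'b; apply: (V t' _).1; lia.
have fH t : (u <= t <= d.+1)%N -> f t = (r + (t - u))%N.
  move=> utd; rewrite -(fV u) ?(@slope_run f u t) //; try lia.
  by move=> t' t'b; apply: (H t' _).1; lia.
have gfam h : (h <= r)%N -> map g (iota h (u.+1 - h)) =
    iota h (r.+1 - h) ++ iota s (d.+1 - s).
  move=> hr; have -> : (u.+1 - h = (r.+1 - h) + (d.+1 - s))%N by lia.
  rewrite iotaD map_cat; congr (_ ++ _).
    by apply: map_iota_shift => t tb; apply: (diag _ _).2; lia.
  by apply: map_iota_shift => t tb; rewrite gV; lia.
have ffam us' : path gtn r us' -> all (leq^~ r) (blocks false r us').
  by move=> p'; apply: blocks_bound; case: us' p' => //= w us' /andP[]; lia.
split.
  case: us p => [|v us] p.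
    rewrite -[blocks _ u _]/(iota 0 u.+1) -[blocks _ r _]/(iota 0 r.+1).
    by rewrite -[u.+1]subn0 gfam // subn0.
  have vr : (v < r)%N by case/andP: p.
  rewrite [blocks _ u _]/= [blocks _ r _]/= map_cat gfam; last by lia.
  rewrite -[RHS]catA; congr (_ ++ _).
  apply: map_id_upto => [t /diag[]//|].
  rewrite (blocks_false _ r); apply: ffam.
  by apply: path_gtn_widen (ltnW vr) _; case/andP: p.
rewrite map_cat (blocks_false u r); congr (_ ++ _).
  by apply: map_id_upto (ffam _ p) => t /diag[].
have -> : (s.+1 - r = d.+2 - u)%N by lia.
by apply: map_iota_shift => t tb; rewrite fH; lia.
Qed.

End Staircase.

(** * Values of a cochain on faces given by vertices *)

Section Operators.
Context (X : sset).
Implicit Types (y : simplex X) (ks : seq nat).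

Lemma tag_dface k y : tag (dface k y) = (tag y).-1.
Proof. by case: y => [[|n] x]. Qed.

Lemma tag_faces ks y : tag (faces ks y) = (tag y - size ks)%N.
Proof. by elim: ks => [|k ks IH] /=; rewrite ?tag_dface ?IH; lia. Qed.

Lemma tag_degens ks y : tag (degens ks y) = (tag y + size ks)%N.
Proof. by elim: ks => [|k ks IH] /=; rewrite ?IH; lia. Qed.

Lemma dface_dface i j y : (1 < tag y)%N -> (i < j <= tag y)%N ->
  dface i (dface j y) = dface j.-1 (dface i y).
Proof. by case: y => [[|[|n]] x] //= _ ij; rewrite face_face. Qed.

Lemma dface_ddegen_lt i j y : (i < j <= tag y)%N ->
  dface i (ddegen j y) = ddegen j.-1 (dface i y).
Proof.
by case: y => [[|n] x] /= ij; [lia|rewrite /ddegen /= face_degen_lt].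
Qed.

Lemma dface_ddegen_id i j y : (j <= tag y)%N -> i = j \/ i = j.+1 ->
  dface i (ddegen j y) = y.
Proof. by case: y => n x /= jn ij; rewrite face_degen_id. Qed.

Lemma dface_ddegen_gt i j y : (j.+1 < i <= (tag y).+1)%N ->
  dface i (ddegen j y) = ddegen j (dface i.-1 y).
Proof.
by case: y => [[|n] x] /= ij; [lia|rewrite /ddegen /= face_degen_gt //; lia].
Qed.

(** A string of face indices in increasing order acts with its largest index
    first; this bound keeps each index within the dimension it is applied
    in. *)
Lemma sorted_size_bound N i ks : path ltn i ks -> all (ltn^~ N) (i :: ks) ->
  (i + size ks < N)%N.
Proof.
elim: ks i => [|k ks IH] i /=; first by rewrite addn0 andbT.
by case/andP=> ik p /andP[iN H]; have := IH k p H; lia.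
Qed.

Lemma faces_dface lo ks y : sorted ltn ks ->
  all (fun i => lo <= i < tag y)%N ks -> (size ks < tag y)%N ->
  faces ks (dface lo y) = dface lo (faces (map S ks) y).
Proof.
elim: ks => //= i ks IH p /andP[/andP[li iy] H] sz.
rewrite IH ?(path_sorted p) //; last by lia.
have b : (i + size ks < tag y)%N.
  by apply: sorted_size_bound p _; rewrite /= iy; apply: sub_all H => t /andP[].
by rewrite [RHS]dface_dface ?tag_faces ?size_map //; lia.
Qed.

Lemma faces_ddegen_high k ks y : sorted ltn ks ->
  all (fun i => k.+1 < i <= (tag y).+1)%N ks ->
  faces ks (ddegen k y) = ddegen k (faces (map predn ks) y).
Proof.
elim: ks => //= i ks IH p /andP[/andP[ki iy] H].
rewrite IH ?(path_sorted p) //.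
have b : (i + size ks < (tag y).+2)%N.
  apply: sorted_size_bound p _; rewrite /= ltnS iy.
  by apply: sub_all H => t /andP[].
by rewrite dface_ddegen_gt // tag_faces size_map ki; lia.
Qed.

Lemma faces_ddegen_low k ks y : sorted ltn ks -> all (ltn^~ k) ks ->
  (k <= tag y)%N -> faces ks (ddegen k y) = ddegen (k - size ks) (faces ks y).
Proof.
elim: ks => [|i ks IH] /=; first by rewrite subn0.
move=> p /andP[ik H] ky; rewrite IH ?(path_sorted p) //.
have b : (i + size ks < k)%N by apply: sorted_size_bound p _; rewrite /= ik.
rewrite dface_ddegen_lt ?tag_faces; last lia.
by congr (ddegen _ _); lia.
Qed.

End Operators.

Definition compl (d : nat) (v : seq nat) : seq nat :=
  [seq k <- iota 0 d.+1 | k \notin v].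

Section VertexLists.
Context (X : sset) (j : nat) (c : cochain X j).
Implicit Types (y : simplex X) (v : seq nat).

(** The simplex with vertex list v is degenerate when v has a repetition; this
    is why the value is then 0, rather than the value on the face spanned by
    the distinct vertices. *)
Definition face_val y v : 'F_2 :=
  if sorted ltn v then pair_faces c (compl (tag y) v) y else 0.

Lemma cls_degenerate n (x : simp X n) : degenerate x -> cls x = 0.
Proof.
move=> dx; rewrite -[0]/(\pi 0); apply/lquotE; rewrite subr0.
by move=> P P0 PD PG; apply/PG/DegenerateChain.
Qed.

Lemma pairing0 k : pairing c (0 : nchain X k) = 0.
Proof. by rewrite /pairing; case: eqP => // e; subst k; rewrite /= raddf0. Qed.

Lemma pairing_ddegen k y :
  (k <= tag y)%N -> pairing c (cls (tagged (ddegen k y))) = 0.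
Proof.
case: y => n x /= kn; rewrite cls_degenerate ?pairing0 //.
by exists n, k, x.
Qed.

Lemma sorted_iota_filter (a : pred nat) u n :
  sorted ltn [seq k <- iota u n | a k].
Proof. exact/sorted_filter/iota_ltn_sorted/ltn_trans. Qed.

Lemma iotaS_map u n : iota u.+1 n = map S (iota u n).
Proof. by rewrite -[u.+1]add1n iotaDl. Qed.

Lemma bump_mono k : {mono bump k : x y / (x < y)%N}.
Proof. by move=> x y; rewrite /bump; lia. Qed.

(** The coface map [bump k] sends the vertices of d_k y to those of y; since
    it omits k, the string for y is the one for d_k y with d_k inserted. *)
Lemma face_val_dface k y v : (k <= tag y)%N -> (0 < size v)%N ->
  all (ltn^~ (tag y)) v -> face_val (dface k y) v = face_val y (map (bump k) v).
Proof.
move=> ky v0 vy; rewrite /face_val sorted_map.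
have -> : sorted (relpre (bump k) ltn) v = sorted ltn v.
  by apply: eq_sorted => x z; apply: bump_mono.
case: ifP => // _; rewrite /compl tag_dface.
have y0 : (0 < tag y)%N by case: v v0 vy => //= x v _ /andP[]; lia.
have -> : (tag y).-1.+1 = (k + (tag y - k))%N by lia.
have -> : (tag y).+1 = (k + (tag y - k).+1)%N by lia.
rewrite !iotaD !filter_cat add0n /= iotaS_map filter_map.
have -> : (k \in map (bump k) v) = false.
  by apply/negP=> /mapP[x _ /eqP]; rewrite (negbTE (neq_bump k x)).
have eqL : [seq t <- iota 0 k | t \notin map (bump k) v] =
           [seq t <- iota 0 k | t \notin v].
  apply: eq_in_filter => t; rewrite mem_iota => tk; congr (~~ _).
  rewrite -[RHS](mem_map (can_inj (bumpK k))).
  by have -> : bump k t = t by rewrite /bump; lia.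
have eqH : [seq t <- iota k (tag y - k) |
                preim S (predC (mem (map (bump k) v))) t] =
           [seq t <- iota k (tag y - k) | t \notin v].
  apply: eq_in_filter => t; rewrite mem_iota /= => tk; congr (~~ _).
  rewrite -[RHS](mem_map (can_inj (bumpK k))).
  by have -> : bump k t = t.+1 by rewrite /bump; lia.
rewrite eqL (eqH : filter _ _ = _) /pair_faces /faces !foldr_cat /=.
congr (pairing c (cls (tagged (foldr _ _ _)))).
apply: faces_dface; first exact: sorted_iota_filter.
  by apply/allP=> t; rewrite mem_filter mem_iota; lia.
rewrite size_filter; case: k ky {eqL eqH} => [|k] ky; last first.
  by apply: leq_ltn_trans (count_size _ _) _; rewrite size_iota; lia.
rewrite subn0 -[ltnRHS](size_iota 0) ltn_neqAle count_size andbT -all_count.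
case: v v0 vy => // x v _ /andP[/= xy _]; apply/negP => /allP/(_ x).
by rewrite mem_iota xy !inE eqxx => /(_ isT).
Qed.

Lemma mem_map_unbump k t v : (t \in map (unbump k) v) =
  [|| (t <= k)%N && (t \in v) | (k <= t)%N && (t.+1 \in v)].
Proof.
apply/mapP/orP=> [[x xv ->]|[/andP[tk tv]|/andP[kt tv]]].
- rewrite /unbump; case: ltnP => kx; last by left; rewrite subn0 kx.
  by right; rewrite subn1 prednK; [rewrite xv andbT|]; lia.
- by exists t => //; rewrite /unbump; lia.
- by exists t.+1 => //; rewrite /unbump; lia.
Qed.

Lemma sorted_map_unbump k v : sorted ltn (map (unbump k) v) =
  sorted ltn v && ~~ ((k \in v) && (k.+1 \in v)).
Proof.
apply/idP/andP=> [s|[s /negP nk]].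
  split.
    rewrite sorted_map in s; apply: sub_sorted s => x z /=.
    by rewrite /unbump; lia.
  apply/negP=> /andP[kv kv'].
  have /(sub_sorted ltnW) : sorted ltn v.
    rewrite sorted_map in s; apply: sub_sorted s => x z /=.
    by rewrite /unbump; lia.
  elim: v s kv kv' => //= x v IH s kv kv' sv.
  have s' := path_sorted s; have sv' := path_sorted sv.
  rewrite (path_sortedE ltn_trans) in s; case/andP: s => /allP lt _.
  move: kv kv'; rewrite !inE => /orP[/eqP xk|kv] /orP[/eqP xk'|kv'].
  - lia.
  - by have := lt _ (map_f (unbump k) kv'); rewrite /unbump; lia.
  - by have := lt _ (map_f (unbump k) kv); rewrite /unbump; lia.
  - exact: IH.
apply: (homo_sorted_in (P := mem v)) (s) => [x z xv zv xz|]; last exact/allP.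
rewrite /unbump; suff : ~ (x = k /\ z = k.+1) by lia.
by case=> xk zk; apply: nk; rewrite -xk xv xk -zk zv.
Qed.

(** The codegeneracy [unbump k] identifies k and k + 1. If one of these
    vertices is omitted then a face cancels s_k. If both are kept then s_k
    commutes to the front, and the value is 0 on either side. *)
Lemma face_val_ddegen k y v : (k <= tag y)%N -> all (leq^~ (tag y).+1) v ->
  face_val (ddegen k y) v = face_val y (map (unbump k) v).
Proof.
move=> ky vy; rewrite /face_val sorted_map_unbump; case: ifP => //= sv.
rewrite /compl.
have -> : (tag y).+2 = (k + (tag y - k).+2)%N by lia.
have -> : (tag y).+1 = (k + (tag y - k).+1)%N by lia.
rewrite !iotaD !filter_cat add0n /= (iotaS_map k.+1) filter_map.
have eqL : [seq t <- iota 0 k | t \notin map (unbump k) v] =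
           [seq t <- iota 0 k | t \notin v].
  apply: eq_in_filter => t; rewrite mem_iota mem_map_unbump => tk.
  have -> : (k <= t)%N = false by lia.
  have -> : (t <= k)%N by lia.
  by rewrite /= orbF.
have eqH : [seq t <- iota k.+1 (tag y - k) | t \notin map (unbump k) v] =
           [seq t <- iota k.+1 (tag y - k) | preim S (predC (mem v)) t].
  apply: eq_in_filter => t; rewrite mem_iota mem_map_unbump => tk.
  have -> : (t <= k)%N = false by lia.
  by have -> : (k <= t)%N by lia.
rewrite eqL eqH mem_map_unbump leqnn /=.
set L := filter _ (iota 0 k); set H := filter _ (iota k.+1 _).
have sH : (size H <= tag y - k)%N.
  by rewrite size_filter -[leqRHS](size_iota k.+1) count_size.
pose z := faces H y; have kz : (k <= tag z)%N by rewrite tag_faces; lia.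
have hH : faces (map S H) (ddegen k y) = ddegen k z.
  rewrite faces_ddegen_high -?map_comp ?map_id //.
    by rewrite sorted_map; apply: sorted_iota_filter.
  by rewrite all_map; apply/allP=> t /=; rewrite mem_filter mem_iota; lia.
rewrite /pair_faces.
case: (k \in v); case: (k.+1 \in v) => /=;
  rewrite /faces !foldr_cat /= -!/(faces _ _) hH ?dface_ddegen_id //; auto.
rewrite faces_ddegen_low //; first 1 last.
- exact: sorted_iota_filter.
- by apply/allP=> t /=; rewrite mem_filter mem_iota; lia.
rewrite pairing_ddegen // tag_faces; lia.
Qed.

Lemma face_val_faces_iota lo n y v :
  (lo + n <= (tag y).+1)%N -> (n <= tag y)%N -> (0 < size v)%N ->
  all (leq^~ (tag y - n)%N) v ->
  face_val (faces (iota lo n) y) v =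
  face_val y (map (fun t => if (t < lo)%N then t else t + n)%N v).
Proof.
elim: n lo v => [|n IH] lo v ln ny v0 vy.
  by rewrite map_id_in // => t _; rewrite addn0 if_same.
rewrite [faces _ _]/= face_val_dface // ?tag_faces ?size_iota; try lia.
  rewrite IH ?size_map //; try lia.
    rewrite -map_comp; congr (face_val y _); apply: eq_map => t /=.
    case: (ltnP t lo) => tl.
      have -> : bump lo t = t by rewrite /bump; lia.
      by rewrite ltnS ltnW.
    have -> : bump lo t = t.+1 by rewrite /bump; lia.
    by rewrite ltnS ltnNge tl addnS.
  by rewrite all_map; apply: sub_all vy => t /=; rewrite /bump; lia.
by apply: sub_all vy => t /=; lia.
Qed.

(** The composite of the codegeneracies of an increasing string moves each
    vertex down by the number of indices below it. *)
Lemma face_val_degens ks y v : sorted ltn ks ->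
  all (ltn^~ (tag y + size ks)%N) ks -> all (leq^~ (tag y + size ks)%N) v ->
  face_val (degens (rev ks) y) v =
  face_val y (map (fun t => t - count (ltn^~ t) ks)%N v).
Proof.
elim/last_ind: ks v => [|ks k IH] v sk ky vy.
  by rewrite map_id_in // => t _; rewrite subn0.
move: ky vy; rewrite all_rcons size_rcons rev_rcons => /andP[/= ky _] vy.
move: sk; rewrite (sorted_pairwise ltn_trans) pairwise_rcons.
rewrite -(sorted_pairwise ltn_trans) => /andP[lk sk].
rewrite [degens _ _]/= face_val_ddegen ?tag_degens ?size_rev; first 1 last.
- by lia.
- by apply: sub_all vy => t /=; lia.
rewrite IH //; first 1 last.
- by apply: sub_all lk => t /=; lia.
- by rewrite all_map; apply: sub_all vy => t /=; rewrite /unbump; lia.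
rewrite -map_comp; congr (face_val y _); apply: eq_map => t /=.
rewrite -cats1 count_cat /= addn0 /unbump.
case: ltnP => kt; last by rewrite subn0 addn0.
have all_lt u : (k <= u)%N -> count (ltn^~ u) ks = size ks.
  move=> ku; apply/eqP; rewrite -all_count.
  by apply: sub_all lk => i /=; lia.
by rewrite !all_lt; lia.
Qed.

End VertexLists.

(** * Maps out of quotients of free modules *)

Section FreeLift.
Context (R : comNzRingType) (T : choiceType) (W : lmodType R).
Implicit Types (f : T -> W) (D : {freeg T / R}).

HB.instance Definition _ f := GRing.isAdditive.Build
  {freeg T / R} W (fglift f) (lift_is_additive f).

Lemma fgliftE f D : fglift f D = \sum_(t <- dom D) coeff t D *: f t.
Proof.
rewrite -{1}[D]freeg_sumE raddf_sum.
by apply: eq_bigr => t _; rewrite [LHS]liftU.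
Qed.

Lemma fglift_scale f a D : fglift f (a *: D) = a *: fglift f D.
Proof.
rewrite [_ *: D]/(fgscale a D) /fgscale raddf_sum fgliftE scaler_sumr.
by apply: eq_bigr => t _; rewrite [LHS]liftU scalerA.
Qed.

Lemma fglift_sum (I : finType) (F : I -> T -> W) D :
  fglift (fun t => \sum_i F i t) D = \sum_i fglift (F i) D.
Proof.
rewrite fgliftE; under [RHS]eq_bigr do rewrite fgliftE.
by rewrite exchange_big; apply: eq_bigr => t _; rewrite scaler_sumr.
Qed.

Lemma fglift1 f t : fglift f << t >> = f t.
Proof. by rewrite [LHS]liftU scale1r. Qed.

End FreeLift.

Lemma fglift_comp (R : comNzRingType) (T : choiceType) (W W' : lmodType R)
    (L : W -> W') (f : T -> W) (D : {freeg T / R}) :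
  linear L -> L (fglift f D) = fglift (L \o f) D.
Proof.
move=> linL.
pose L' : {linear W -> W'} := HB.pack L (GRing.isLinear.Build _ _ _ _ L linL).
rewrite -[L]/(L' : W -> W') fgliftE raddf_sum fgliftE.
by apply: eq_bigr => t _; rewrite [LHS]linearZ_LR.
Qed.

Section QuotientLift.
Context (R : comNzRingType) (T : choiceType) (W : lmodType R).
Context (G : {freeg T / R} -> Prop) (f : T -> W).
Hypothesis f_kills : forall g, G g -> fglift f g = 0.

Lemma fglift_span D : Defs.span G D -> fglift f D = 0.
Proof.
move/(_ (fun D => fglift f D = 0)); apply=> [|a u w fu fw|//].
  exact: raddf0.
by rewrite raddfD /= fglift_scale fu fw scaler0 addr0.
Qed.

(** Two representatives differ by a combination of relations, on which the
    formula vanishes. *)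
Lemma lift_gen_pi D : lift_gen f (\pi_(lquot G) D) = fglift f D.
Proof.
apply/eqP; rewrite -subr_eq0 /lift_gen -raddfB /=; apply/eqP/fglift_span.
exact: span_repr.
Qed.

Lemma lift_gen_linear : linear (lift_gen f : lquot G -> W).
Proof.
move=> a; elim/quotW=> u; elim/quotW=> v.
rewrite [_ *: _]lquot_scaleE [_ + _ as X in lift_gen _ X]lquot_addE.
rewrite !lift_gen_pi.
by rewrite raddfD /= fglift_scale.
Qed.

End QuotientLift.

Section Tensor.
Context (R : comNzRingType) (M N : lmodType R).
Implicit Types (u : M) (v : N).

Let tensE (D D' : {freeg (M * N)%type / R}) : tensor_rel (D - D') ->
  \pi_(lquot (@tensor_rel R M N)) D = \pi_(lquot (@tensor_rel R M N)) D'.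
Proof. by move=> rel; apply/lquotE => P P0 PD; apply. Qed.

Lemma tensDl u u' v : tens (u + u') v = tens u v + tens u' v.
Proof.
rewrite [RHS]lquot_addE; apply: tensE; rewrite opprD addrA; exact: TensorAddl.
Qed.

Lemma tensDr u v v' : tens u (v + v') = tens u v + tens u v'.
Proof.
rewrite [RHS]lquot_addE; apply: tensE; rewrite opprD addrA; exact: TensorAddr.
Qed.

Lemma tensZl a u v : tens (a *: u) v = a *: tens u v.
Proof. rewrite [RHS]lquot_scaleE; apply: tensE; exact: TensorScalel. Qed.

Lemma tensZr a u v : tens u (a *: v) = a *: tens u v.
Proof. rewrite [RHS]lquot_scaleE; apply: tensE; exact: TensorScaler. Qed.

Lemma bilinear_kills (W : lmodType R) (h : (M * N)%type -> W) :
  (forall v, linear (fun u => h (u, v))) ->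
  (forall u, linear (fun v => h (u, v))) ->
  forall g, tensor_rel g -> fglift h g = 0.
Proof.
move=> hl hr g.
have hDl u u' v : h (u + u', v) = h (u, v) + h (u', v).
  by have := hl v 1 u u'; rewrite !scale1r.
have hDr u v v' : h (u, v + v') = h (u, v) + h (u, v').
  by have := hr u 1 v v'; rewrite !scale1r.
have h0l v : h (0, v) = 0 by apply: (addrI (h (0, v))); rewrite -hDl !addr0.
have h0r u : h (u, 0) = 0 by apply: (addrI (h (u, 0))); rewrite -hDr !addr0.
case=> [u u' v|u v v'|a u v|a u v];
  rewrite !raddfB /= ?fglift_scale !fglift1.
- by rewrite hDl -addrA -opprD addrN.
- by rewrite hDr -addrA -opprD addrN.
- by have := hl v a u 0; rewrite addr0 h0l addr0 => ->; rewrite subrr.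
- by have := hr u a v 0; rewrite addr0 h0r addr0 => ->; rewrite subrr.
Qed.

End Tensor.

Section TensorMap.
Context (R : comNzRingType) (M N M' N' : lmodType R).
Context (f : M -> M') (g : N -> N').
Hypotheses (linf : linear f) (ling : linear g).

Let tens_linear_l v : linear (fun u => tens (f u) (g v)).
Proof. by move=> a u u' /=; rewrite linf tensDl tensZl. Qed.

Let tens_linear_r u : linear (fun v => tens (f u) (g v)).
Proof. by move=> a v v' /=; rewrite ling tensDr tensZr. Qed.

Let tensor_map_kills D : tensor_rel D ->
  fglift (fun w : (M * N)%type => tens (f w.1) (g w.2)) D = 0.
Proof. exact: bilinear_kills. Qed.

Lemma tensor_map_linear : linear (tensor_map f g).
Proof. exact/lift_gen_linear/tensor_map_kills. Qed.

Lemma tensor_map_tens u v : tensor_map f g (tens u v) = tens (f u) (g v).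
Proof. by rewrite [LHS](lift_gen_pi tensor_map_kills) fglift1. Qed.

End TensorMap.

Lemma mu_kills g : tensor_rel g ->
  fglift (fun w : (('F_2)^o * ('F_2)^o)%type => w.1 * w.2 : ('F_2)^o) g = 0.
Proof.
apply: bilinear_kills => [v|u] a w w' /=.
  by rewrite mulrDl; congr (_ + _); apply/esym/mulrA.
by rewrite mulrDr; congr (_ + _); apply: mulrCA.
Qed.

Lemma mu_linear : linear (mu : _ -> ('F_2)^o).
Proof. exact/lift_gen_linear/mu_kills. Qed.

Lemma mu_tens (a b : ('F_2)^o) : mu (tens a b) = a * b.
Proof. by rewrite [LHS](lift_gen_pi mu_kills) fglift1. Qed.

(** * The functional obtained from AW and SHI *)

Lemma compl_front p m : (p <= m)%N -> compl m (iota 0 p.+1) = iota p.+1 (m - p).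
Proof.
move=> pm; rewrite /compl -(subnKC pm) -addSn iotaD filter_cat addKn.
rewrite (eq_in_filter (a2 := pred0)) ?filter_pred0; last first.
  by move=> t; rewrite !mem_iota => ->.
by apply/all_filterP/allP=> t; rewrite !mem_iota; lia.
Qed.

Lemma compl_back p m : (p <= m)%N -> compl m (iota p (m.+1 - p)) = iota 0 p.
Proof.
move=> pm; rewrite /compl -(subnKC (leqW pm)) iotaD filter_cat addKn add0n.
rewrite [X in _ ++ X](eq_in_filter (a2 := pred0)) ?filter_pred0 ?cats0.
  by apply/all_filterP/allP=> t; rewrite !mem_iota; lia.
by move=> t ->.
Qed.

Section ProductFunctional.
Context (X : sset) (g : simplex X -> simplex X -> ('F_2)^o).

Definition prod_lift m (z : nchain (sprod X X) m) : ('F_2)^o :=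
  lift_gen (fun w : {classic simp (sprod X X) m} =>
    g (Tagged (simp X) w.1) (Tagged (simp X) w.2)) z.

Hypothesis g_ddegen : forall k a b, tag a = tag b -> (k <= tag a)%N ->
  g (ddegen k a) (ddegen k b) = 0.

(** A degenerate simplex of the product is s_i of a pair: both components are
    degenerate along the same edge. *)
Lemma prod_kills m D : degenerate_chain D ->
  fglift (fun w : {classic simp (sprod X X) m} =>
    g (Tagged (simp X) w.1) (Tagged (simp X) w.2)) D = 0.
Proof.
case=> x [k [i [y [ik E]]]]; rewrite fglift1.
pose h (u : simplex (sprod X X)) :=
  g (Tagged (simp X) (tagged u).1) (Tagged (simp X) (tagged u).2).
rewrite -[LHS]/(h (Tagged (simp (sprod X X)) x)) E.
exact: (@g_ddegen i (Tagged (simp X) y.1) (Tagged (simp X) y.2)).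
Qed.

Lemma prod_lift_linear m : linear (@prod_lift m).
Proof. exact: (lift_gen_linear (@prod_kills m)). Qed.

Lemma prod_lift_cls m (x y : simp X m) :
  prod_lift (@cls (sprod X X) m (x, y)) =
  g (Tagged (simp X) x) (Tagged (simp X) y).
Proof. by rewrite [LHS](lift_gen_pi (@prod_kills m)) fglift1. Qed.

End ProductFunctional.

(** The functional respects degenerate simplices, so the representative chosen
    in the definition of the swap is immaterial once the functional is
    applied. *)
Lemma prod_lift_swap X g :
  (forall k a b, tag a = tag b -> (k <= tag a)%N ->
     g (ddegen k a) (ddegen k b) = 0) ->
  forall m (z : nchain (sprod X X) m),
  prod_lift g (swap z) = prod_lift (fun a b => g b a) z.
Proof.
move=> g_ddegen m z; rewrite /swap /lift_gen fglift_comp; last first.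
  exact: prod_lift_linear.
rewrite /prod_lift /lift_gen; congr (fglift _ _); apply/funext=> w /=.
exact: (prod_lift_cls g_ddegen).
Qed.

Section Functional.
Context (X : sset) (j : nat) (c : cochain X j).

Lemma pairing_linear k : linear (@pairing X j c k).
Proof.
rewrite /pairing; case: eqP => [e|_] a u v; last by rewrite scaler0 addr0.
by subst k; rewrite /= linearP.
Qed.

Lemma pairing_cls_in k (y : simplex X) : tag y = k ->
  pairing c (cls_in k y) = pairing c (cls (tagged y)).
Proof. by move=> e; subst k; rewrite /cls_in untagE. Qed.

(** The value of c (x) c on the n-th operation AW (t SHI)^n, written for pairs
    of simplices: for a = b this is Steenrod's formula for the cup-n
    square. *)
Definition cup (n : nat) (a b : simplex X) : ('F_2)^o :=
  sum_decr n.+1 (tag a).+1 (fun us =>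
    face_val c a (blocks false (tag a) us) *
    face_val c b (blocks true (tag a) us)).

Lemma face_val_ddegen_eq0 k y v : (k <= tag y)%N -> all (leq^~ (tag y).+1) v ->
  k \in v -> k.+1 \in v -> face_val c (ddegen k y) v = 0.
Proof.
move=> ky vy kv kv'; rewrite face_val_ddegen // /face_val sorted_map_unbump.
by rewrite kv kv' andbF.
Qed.

(** The edge from k to k + 1 lies in one of the intervals, and it is collapsed
    in both components. *)
Lemma cup_ddegen n k a b : tag a = tag b -> (k <= tag a)%N ->
  cup n (ddegen k a) (ddegen k b) = 0.
Proof.
move=> ab ka; apply: sum_decr0 => us _ p.
have [|[] /andP[h1 h2]] := blocks_step (k := k) _ p; first by rewrite ltnS.
  rewrite [X in _ * X]face_val_ddegen_eq0 ?mulr0 -?ab //; exact: blocks_bound.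
by rewrite [X in X * _]face_val_ddegen_eq0 ?mul0r //; exact: blocks_bound.
Qed.

Lemma cup_flip_ddegen n k a b : tag a = tag b -> (k <= tag a)%N ->
  cup n (ddegen k b) (ddegen k a) = 0.
Proof. by move=> ab ka; apply: cup_ddegen; rewrite -?ab. Qed.

Definition cup_chain n m : nchain (sprod X X) m -> ('F_2)^o :=
  @prod_lift X (cup n) m.

Lemma cup_chain_swap_linear n m :
  linear (fun z : nchain (sprod X X) m => cup_chain n (swap z)).
Proof.
move=> a u v; rewrite /cup_chain !(prod_lift_swap (@cup_ddegen n)).
exact: (prod_lift_linear (@cup_flip_ddegen n)).
Qed.

Lemma cup_chain_swap_cross n m (a b : simplex X) : tag a = m -> tag b = m ->
  cup_chain n (swap (cross_in m a b)) = cup n b a.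
Proof.
case: a b => [ma a] [mb b] /= ea eb; subst ma; subst mb.
rewrite /cup_chain (prod_lift_swap (@cup_ddegen n)) /cross_in !untagE.
exact: (prod_lift_cls (@cup_flip_ddegen n)).
Qed.

(** The term of AW of index p is the cut at the single point p. *)
Lemma mu_pairing2_AW m (z : nchain (sprod X X) m) :
  mu (pairing2 c (AW z)) = cup_chain 0 z.
Proof.
have linmu p q : linear (fun t =>
    mu (tensor_map (@pairing X j c p) (@pairing X j c q) t) : ('F_2)^o).
  move=> a u v.
  rewrite (tensor_map_linear (@pairing_linear p) (@pairing_linear q)).
  by rewrite mu_linear.
have -> : mu (pairing2 c (AW z)) = \sum_(p < m.+1)
    (mu (tensor_map (@pairing X j c p) (@pairing X j c (m - p)) (AW z p))
      : ('F_2)^o).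
  pose mu' : {linear _ -> ('F_2)^o} :=
    HB.pack (mu : _ -> ('F_2)^o) (GRing.isLinear.Build _ _ _ _ _ mu_linear).
  by rewrite -[mu]/(mu' : _ -> _) [LHS]raddf_sum.
rewrite /AW /cup_chain /prod_lift /lift_gen.
under eq_bigr => p _ do rewrite (fglift_comp _ _ (linmu _ _)).
rewrite -fglift_sum.
rewrite [LHS]fgliftE [RHS]fgliftE; apply: eq_bigr => w _.
apply: (congr1 (fun v : 'F_2 => coeff w (repr z) * v)).
rewrite /=.
apply: eq_bigr => p _; rewrite tensor_map_tens; try exact: pairing_linear.
have pm : (p <= m)%N by rewrite -ltnS.
rewrite mu_tens !pairing_cls_in ?tag_faces ?size_iota; first 1 last.
- by rewrite /=; lia.
- by rewrite /=; lia.
have blocks_t : blocks true m [:: (p : nat)] = iota p (m.+1 - p) by [].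
have blocks_f : blocks false m [:: (p : nat)] = iota 0 p.+1 by [].
rewrite blocks_t blocks_f /face_val !iota_ltn_sorted.
rewrite -!/(pair_faces c _ _) -!/(tag _) /=.
by rewrite compl_front // compl_back // /index_iota subn0.
Qed.

End Functional.

(** * The summands of SHI as lattice paths *)

Lemma count_ltS (s : seq nat) k : uniq s ->
  count (ltn^~ k.+1) s = (count (ltn^~ k) s + (k \in s))%N.
Proof.
move=> us; rewrite -count_uniq_mem //.
rewrite -count_predUI (@eq_count _ (predI _ _) pred0) => [|t /=]; last lia.
by rewrite count_pred0 addn0; apply: eq_count => t /=; lia.
Qed.

Section ShuffleLists.
Context (n : nat).
Implicit Types (A : {set 'I_n}).

Lemma sorted_shuffle_alpha A : sorted ltn (shuffle_alpha A).
Proof.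
apply: (subseq_sorted ltn_trans) (iota_ltn_sorted 0 n).
rewrite -val_enum_ord /shuffle_alpha; apply: map_subseq.
by rewrite enumT; apply: filter_subseq.
Qed.

Lemma mem_shuffle_alpha A (k : 'I_n) : (val k \in shuffle_alpha A) = (k \in A).
Proof. by rewrite mem_map ?mem_enum //; apply: val_inj. Qed.

Lemma shuffle_alpha_lt A : all (ltn^~ n) (shuffle_alpha A).
Proof. by apply/allP=> _ /mapP[k _ ->]; apply: ltn_ord. Qed.

Lemma size_shuffle_alpha A : size (shuffle_alpha A) = #|A|.
Proof. by rewrite size_map -cardE. Qed.

Definition below A (t : nat) : nat := count (ltn^~ t) (shuffle_alpha A).

Lemma belowS A (k : 'I_n) : below A k.+1 = (below A k + (k \in A))%N.
Proof.
rewrite -mem_shuffle_alpha; apply: count_ltS.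
exact: (sorted_uniq ltn_trans ltnn (sorted_shuffle_alpha A)).
Qed.

Lemma below0 A : below A 0 = 0%N.
Proof. by rewrite /below (@eq_count _ _ pred0) ?count_pred0. Qed.

Lemma below_all A : below A n = #|A|.
Proof.
by rewrite -size_shuffle_alpha; apply/eqP; rewrite -all_count shuffle_alpha_lt.
Qed.

Lemma below_le A t : (below A t <= #|A|)%N.
Proof. by rewrite -size_shuffle_alpha count_size. Qed.

Lemma belowC A t : (t <= n)%N -> (below A t + below (~: A) t)%N = t.
Proof.
elim: t => [|t IH] tn; first by rewrite !below0.
rewrite -[t]/(val (Ordinal tn)) !belowS in_setC /=.
by case: (_ \in A); have := IH (ltnW tn); rewrite /=; lia.
Qed.

End ShuffleLists.

Lemma count_shift (mb t : nat) (l : seq nat) :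
  count (ltn^~ t) [seq (k + mb)%N | k <- l] = count (ltn^~ (t - mb)%N) l.
Proof. by rewrite count_map; apply: eq_count => k /=; lia. Qed.

Lemma sorted_shift (mb : nat) (l : seq nat) :
  sorted ltn l -> sorted ltn [seq (k + mb)%N | k <- l].
Proof.
by rewrite sorted_map; apply: sub_sorted => x y /=; rewrite ltn_add2r.
Qed.

Section Path.
Context (m p q : nat) (A : {set 'I_(p.+1 + q)}).
Hypothesis cardA : #|A| = p.+1.

Lemma cardCA : #|~: A| = q.
Proof. by have := cardsC A; rewrite card_ord; lia. Qed.

Hypotheses (qm : (q < m)%N) (pm : (p < m - q)%N).

Let s := (m - q)%N.
Let r := (s - p.+1)%N.

Definition path_fst t := (if t <= r then t else r + below A (t - r.+1))%N.
Definition path_snd t := (if t <= r then t else s + below (~: A) (t - r.+1))%N.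

(** With s = m - q and r = m - p - q - 1, the degeneracies of index alpha
    repeat a vertex in the second factor, so that alpha lists the horizontal
    steps and beta the vertical ones. *)
Lemma path_staircase : staircase r s m path_fst path_snd.
Proof.
rewrite /path_fst /path_snd; split=> [t -> //||t /andP[rt tm]|].
- by rewrite ltnn subnn !below0 !addn0.
- have tN : (t - r.+1 < p.+1 + q)%N by rewrite /r /s; lia.
  have -> : (t.+1 <= r)%N = false by lia.
  have -> : (t <= r)%N = false by lia.
  have -> : (t.+1 - r.+1 = (Ordinal tN).+1)%N by rewrite /=; lia.
  rewrite !belowS in_setC -[(t - r.+1)%N]/(val (Ordinal tN)).
  by case: (_ \in A); rewrite /= ?addn0 ?addn1 ?addnS; [left|right].
- have -> : (m.+1 <= r)%N = false by rewrite /r /s; lia.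
  have -> : (m.+1 - r.+1 = p.+1 + q)%N by rewrite /r /s; lia.
  by rewrite !below_all cardA cardCA /r /s; lia.
Qed.

Context (X : sset) (j : nat) (c : cochain X j).

Section First.
Context (a : simplex X).
Hypothesis ta : tag a = m.

Definition shi_fst : simplex X :=
  degens [seq (k + (m - p - q))%N | k <- rev (shuffle_beta A)]
    (ddegen (m - p - q).-1 (faces (index_iota (m - q).+1 m.+1) a)).

Lemma tag_shi_fst : tag shi_fst = m.+1.
Proof.
rewrite tag_degens size_map size_rev (size_shuffle_alpha (~: A)).
by rewrite cardCA /= tag_faces size_iota ta; lia.
Qed.

(** The degeneracies of index beta lower the vertex beyond the jump to r + 1
    plus the number of horizontal steps made; the extra degeneracy at r lowers
    it by one more; the last faces of a leave the vertices up to s in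
    place. *)
Lemma face_val_shi_fst v : (0 < size v)%N -> all (leq^~ m.+1) v ->
  face_val c shi_fst v = face_val c a (map path_fst v).
Proof.
move=> v0 vm; rewrite /shi_fst map_rev.
have -> : (m - p - q = r.+1)%N by rewrite /r /s; lia.
have sz : size [seq (k + r.+1)%N | k <- shuffle_beta A] = q.
  by rewrite size_map (size_shuffle_alpha (~: A)) cardCA.
have tf : tag (faces (index_iota (m - q).+1 m.+1) a) = s.
  by rewrite tag_faces size_iota ta /s; lia.
rewrite face_val_degens; first 1 last.
- exact/sorted_shift/sorted_shuffle_alpha.
- rewrite sz all_map; apply: sub_all (shuffle_alpha_lt (~: A)) => k /=.
  by rewrite tf /r /s; lia.
- by apply: sub_all vm => k; rewrite sz /= tf /s; lia.
have val1 t : (t <= m.+1)%N ->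
    (t - count (ltn^~ t) [seq (k + r.+1)%N | k <- shuffle_beta A])%N =
    (if t <= r then t else r.+1 + below A (t - r.+1))%N.
  move=> tm; rewrite count_shift -/(below (~: A) _).
  case: leqP => tr.
    have -> : (t - r.+1 = 0)%N by lia.
    by rewrite below0 subn0.
  have tN : (t - r.+1 <= p.+1 + q)%N by rewrite /r /s; lia.
  by have := belowC A tN; lia.
rewrite face_val_ddegen ?tf; first 1 last.
- by rewrite /r; lia.
- rewrite all_map; apply/allP=> t tv; have tm := allP vm t tv.
  rewrite /= val1 //; have := below_le A (t - r.+1); rewrite cardA.
  by case: (leqP t r); rewrite /r /s; lia.
rewrite /index_iota face_val_faces_iota ?size_map ?ta; first 1 last.
- by lia.
- by lia.
- by [].
- rewrite !all_map; apply/allP=> t tv; have tm := allP vm t tv.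
  rewrite /= val1 //; have := below_le A (t - r.+1); rewrite cardA /unbump.
  by case: (leqP t r); rewrite /r /s; lia.
congr (face_val c a _); rewrite -map_comp -map_comp; apply/eq_in_map => t tv.
have tm := allP vm t tv.
rewrite /= val1 // /path_fst /unbump.
have := below_le A (t - r.+1); rewrite cardA.
by case: (leqP t r); case: ifP; rewrite /r /s; lia.
Qed.

End First.

Section Second.
Context (b : simplex X).
Hypothesis tb : tag b = m.

Definition shi_snd : simplex X :=
  degens [seq (k + (m - p - q))%N | k <- rev (shuffle_alpha A)]
    (faces (index_iota (m - p - q) (m - q)) b).

Lemma tag_shi_snd : tag shi_snd = m.+1.
Proof.
rewrite tag_degens size_map size_rev size_shuffle_alpha cardA tag_faces.
by rewrite size_iota tb; lia.
Qed.

(** Here the faces between r and s make the jump, by shifting all vertices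
    beyond r upwards. *)
Lemma face_val_shi_snd v : (0 < size v)%N -> all (leq^~ m.+1) v ->
  face_val c shi_snd v = face_val c b (map path_snd v).
Proof.
move=> v0 vm; rewrite /shi_snd map_rev.
have -> : (m - p - q = r.+1)%N by rewrite /r /s; lia.
have sz : size [seq (k + r.+1)%N | k <- shuffle_alpha A] = p.+1.
  by rewrite size_map size_shuffle_alpha cardA.
have tf : tag (faces (index_iota r.+1 (m - q)) b) = (r.+1 + q)%N.
  by rewrite tag_faces size_iota tb /r /s; lia.
rewrite face_val_degens; first 1 last.
- exact/sorted_shift/sorted_shuffle_alpha.
- rewrite sz all_map; apply: sub_all (shuffle_alpha_lt A) => k /=.
  by rewrite tf; lia.
- by apply: sub_all vm => k; rewrite sz /= tf /r /s; lia.
have val1 t : (t <= m.+1)%N ->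
    (t - count (ltn^~ t) [seq (k + r.+1)%N | k <- shuffle_alpha A])%N =
    (if t <= r then t else r.+1 + below (~: A) (t - r.+1))%N.
  move=> tm; rewrite count_shift -/(below A _).
  case: leqP => tr.
    have -> : (t - r.+1 = 0)%N by lia.
    by rewrite below0 subn0.
  have tN : (t - r.+1 <= p.+1 + q)%N by rewrite /r /s; lia.
  by have := belowC A tN; lia.
rewrite /index_iota face_val_faces_iota ?size_map ?tb; first 1 last.
- by rewrite /r /s; lia.
- by lia.
- by [].
- rewrite !all_map; apply/allP=> t tv; have tm := allP vm t tv.
  rewrite /= val1 //; have := below_le (~: A) (t - r.+1); rewrite cardCA.
  by case: (leqP t r); rewrite /r /s; lia.
congr (face_val c b _); rewrite -map_comp; apply/eq_in_map => t tv.
have tm := allP vm t tv.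
rewrite /= val1 // /path_snd.
by case: (leqP t r); case: ifP; rewrite /r /s; lia.
Qed.

End Second.

End Path.

(** * One application of t SHI adds a cut point *)

Lemma blocks_size_gt0 d us : path gtn d.+1 us ->
  (0 < size (blocks true d us))%N.
Proof.
by case: us => //= u us /andP[ud _]; rewrite size_cat size_iota; lia.
Qed.

Section VerticalFirst.
Context (m p q : nat).

Definition vertical_first : {set 'I_(p.+1 + q)} :=
  [set k : 'I_(p.+1 + q) | (q <= k)%N].

Lemma card_vertical_first : #|vertical_first| = p.+1.
Proof.
have := cardsC vertical_first; rewrite card_ord.
suff -> : #|~: vertical_first| = q by lia.
have -> : ~: vertical_first =
    widen_ord (leq_addl p.+1 q) @: [set: 'I_q].
  apply/setP=> k; rewrite !inE -ltnNge.
  apply/idP/imsetP => [kq|[i _ ->]]; last exact: (ltn_ord i).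
  by exists (Ordinal kq) => //; apply: val_inj.
rewrite card_imset ?cardsT ?card_ord // => k1 k2 /(congr1 val) /= ?.
exact: val_inj.
Qed.

(** The shuffle can be recovered from its path. *)
Lemma path_fst_step (A : {set 'I_(p.+1 + q)}) (k : 'I_(p.+1 + q)) :
  path_fst m A ((m - q - p.+1).+1 + k).+1 =
  (path_fst m A ((m - q - p.+1).+1 + k) + (k \in A))%N.
Proof.
set r := (m - q - p.+1)%N; rewrite /path_fst -/r.
have -> : ((r.+1 + k).+1 <= r)%N = false by lia.
have -> : (r.+1 + k <= r)%N = false by lia.
have -> : ((r.+1 + k).+1 - r.+1 = k.+1)%N by lia.
by rewrite addKn belowS addnA.
Qed.

End VerticalFirst.

Section ShuffleSum.
Context (X : sset) (j : nat) (c : cochain X j) (m p q n : nat).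
Hypotheses (qm : (q < m)%N) (pm : (p < m - q)%N).
Context (a b : simplex X).

Let s := (m - q)%N.
Let r := (s - p.+1)%N.

Let term (A : {set 'I_(p.+1 + q)}) u us : ('F_2)^o :=
  face_val c b (map (path_snd m A) (blocks true u us)) *
  face_val c a (map (path_fst m A) (blocks false u us ++ iota u (m.+2 - u))).

(** By [stair_forced], a nonzero term determines the shuffle, the largest cut
    point, and the room for the other ones. *)
Lemma term_forced (A : {set 'I_(p.+1 + q)}) u us : #|A| = p.+1 ->
  (u <= m.+1)%N -> path gtn u us -> term A u us != 0 ->
  [/\ u = (r.+1 + q)%N, path gtn r us & A = vertical_first p q].
Proof.
move=> cardA um pus; rewrite /term /face_val.
case: ifP => [sg|_]; last by rewrite mul0r eqxx.
case: ifP => [sf _|_]; last by rewrite mulr0 eqxx.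
have rs : (r < s)%N by rewrite /r /s; lia.
have sm : (s <= m)%N by rewrite /s; lia.
have st := path_staircase cardA qm pm.
have [uE pr V H] := stair_forced rs sm st um pus sg sf.
have uE' : u = (r.+1 + q)%N by rewrite uE /s; lia.
split=> //; apply/setP=> k; rewrite inE.
have : path_fst m A (r.+1 + k).+1 = (path_fst m A (r.+1 + k) + (k \in A))%N.
  exact: path_fst_step.
have kN := ltn_ord k; case: (leqP q k) => qk.
  by have [] := H (r.+1 + k)%N; [rewrite uE' /r /s; lia|case: (k \in A); lia].
by have [] := V (r.+1 + k)%N; [rewrite uE'; lia|case: (k \in A); lia].
Qed.

Lemma term_vertical_first us : path gtn r us ->
  term (vertical_first p q) (r.+1 + q) us =
  face_val c b (blocks true r us ++ iota s (m.+1 - s)) *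
  face_val c a (blocks false r us ++ iota r (s.+1 - r)).
Proof.
move=> pr; have st := path_staircase (card_vertical_first p q) qm pm.
have rs : (r < s)%N by rewrite /r /s; lia.
have sm : (s <= m)%N by rewrite /s; lia.
have step t : (r < t <= m)%N ->
    path_fst m (vertical_first p q) t.+1 =
    (path_fst m (vertical_first p q) t + (r.+1 + q <= t))%N.
  move=> rt; have kN : (t - r.+1 < p.+1 + q)%N by rewrite /r /s; lia.
  have := path_fst_step m (vertical_first p q) (Ordinal kN); rewrite inE /=.
  rewrite -/s -/r.
  have -> : (r.+1 + (t - r.+1) = t)%N by lia.
  by move=> ->; congr (_ + nat_of_bool _)%N; lia.
rewrite /term.
have [| | |-> ->] // := stair_value rs sm st pr (u := (r.+1 + q)%N).
- by rewrite /s; lia.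
- move=> t rt; have := step t; case: (stair_step st (t := t)) => //; lia.
- move=> t rt; have := step t; case: (stair_step st (t := t)) => //; lia.
Qed.

Hypotheses (ta : tag a = m) (tb : tag b = m).

Lemma cup_shi (A : {set 'I_(p.+1 + q)}) : #|A| = p.+1 ->
  cup c n (shi_snd m A b) (shi_fst m A a) =
  \sum_(u < m.+2) sum_decr n u (term A u).
Proof.
move=> cardA; rewrite /cup tag_shi_snd //.
rewrite sum_decrS; apply: eq_bigr => u _; apply: eq_sum_decr => us _ pu.
have pus : path gtn m.+2 ((u : nat) :: us) by rewrite /= ltn_ord.
rewrite face_val_shi_fst //; first 1 last.
- exact: (blocks_size_gt0 pus).
- exact: (blocks_bound true pus).
rewrite face_val_shi_snd //; last exact: (blocks_bound false pus).
by apply: blocks_size_gt0; apply: path_gtn_widen (leqnSn _) pu.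
Qed.

Lemma sum_shuffles :
  \sum_(A : {set 'I_(p.+1 + q)} | #|A| == p.+1)
    cup c n (shi_snd m A b) (shi_fst m A a) =
  sum_decr n r (fun us =>
    face_val c a (blocks false r us ++ iota r (s.+1 - r)) *
    face_val c b (blocks true r us ++ iota s (m.+1 - s))).
Proof.
rewrite (eq_bigr _ (fun A cA => cup_shi (eqP cA))).
rewrite (bigD1 (vertical_first p q)) ?card_vertical_first //=.
rewrite [X in _ + X]big1 ?addr0; last first.
  move=> A /andP[/eqP cardA nA]; apply: big1 => u _.
  apply: sum_decr0 => us _ pus; apply/eqP; apply: contraNT nA.
  move=> /(term_forced cardA (ltn_ord u) pus).
  by case=> _ _ ->.
have uN : (r.+1 + q < m.+2)%N by rewrite /r /s; lia.
rewrite (bigD1 (Ordinal uN)) //= [X in _ + X]big1 ?addr0; last first.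
  move=> u nu; apply: sum_decr0 => us _ pus; apply/eqP; apply: contraNT nu.
  case/(term_forced (card_vertical_first p q) (ltn_ord u) pus) => uE _ _.
  by apply/eqP/val_inj.
rewrite (sum_decr_narrow (r := r)).
- by apply: eq_sum_decr => us _ pr; rewrite term_vertical_first // mulrC.
- by lia.
- move=> us _ pus; apply: contraNeq.
  by case/(term_forced (card_vertical_first p q) _ pus).
Qed.

End ShuffleSum.

Section Iterate.
Context (X : sset) (j : nat) (c : cochain X j).

(** The substitution s = m - q, r = m - q - p - 1 turns the ranges of SHI into
    r < s <= m. *)
Lemma sum_triangle (m : nat) (V : nmodType) (H : nat -> nat -> V) :
  \sum_(q < m) \sum_(p < m - q) H (m - q)%N (m - q - p.+1)%N =
  \sum_(s < m.+1) \sum_(r < s) H s r.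
Proof.
rewrite [RHS]big_ord_recl big_ord0 add0r [RHS](reindex_inj rev_ord_inj) /=.
apply: eq_bigr => q _; rewrite [RHS](reindex_inj rev_ord_inj) /=.
suff -> : bump 0 (m - q.+1) = (m - q)%N by [].
by rewrite /bump /=; have := ltn_ord q; lia.
Qed.

Lemma cup_chain_swap_SHI_simplex n m (x y : simp X m) :
  cup_chain c n (swap (SHI_simplex x y)) =
  cup c n.+1 (Tagged (simp X) x) (Tagged (simp X) y).
Proof.
pose L' : {linear nchain (sprod X X) m.+1 -> ('F_2)^o} :=
  HB.pack (fun z => cup_chain c n (swap z))
    (GRing.isLinear.Build _ _ _ _ _ (@cup_chain_swap_linear X j c n m.+1)).
pose a := Tagged (simp X) x; pose b := Tagged (simp X) y.
pose H s r := sum_decr n r (fun us =>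
  face_val c a (blocks false r us ++ iota r (s.+1 - r)) *
  face_val c b (blocks true r us ++ iota s (m.+1 - s)) : ('F_2)^o).
transitivity (\sum_(s < m.+1) \sum_(r < s) H s r); last by [].
rewrite -sum_triangle -[LHS]/(L' _) /SHI_simplex raddf_sum.
apply: eq_bigr => q _; rewrite raddf_sum; apply: eq_bigr => p _.
rewrite raddf_sum /H -sum_shuffles //.
apply: eq_bigr => A /eqP cardA; rewrite [LHS]linearZ_LR.
have -> : (-1 : 'F_2) = 1 by apply/eqP.
rewrite expr1n scale1r [LHS]cup_chain_swap_cross //.
- exact: (tag_shi_fst cardA (ltn_ord q) (ltn_ord p)).
- exact: (tag_shi_snd cardA (ltn_ord q) (ltn_ord p)).
Qed.

(** A linear functional composed with [lift_gen] is again a lift, so the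
    computation on pairs of simplices extends to all chains. *)
Lemma cup_chain_swap_SHI n m (z : nchain (sprod X X) m) :
  cup_chain c n (swap (SHI z)) = cup_chain c n.+1 z.
Proof.
rewrite /SHI /lift_gen.
rewrite (fglift_comp _ _ (@cup_chain_swap_linear X j c n m.+1)).
rewrite /cup_chain /prod_lift /lift_gen; congr (fglift _ _).
apply/funext=> w /=; exact: cup_chain_swap_SHI_simplex.
Qed.

Lemma cup_chain_swapSHI n k m (z : nchain (sprod X X) m) :
  cup_chain c n (swapSHI k z) = cup_chain c (k + n) z.
Proof.
by elim: k n => //= k IH n; rewrite cup_chain_swap_SHI IH addnS.
Qed.

Lemma Sq_cup i (x : simp X (i + j)) : (i <= j)%N ->
  Sq c (cls x) = cup c (j - i) (Tagged (simp X) x) (Tagged (simp X) x).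
Proof.
move=> ij; rewrite /Sq ij.
have E (w : {classic simp X (i + j)}) :
    mu (pairing2 c (AW (swapSHI (j - i) (@cls (sprod X X) _ (w, w))))) =
    cup c (j - i) (Tagged (simp X) (w : simp X (i + j)))
                  (Tagged (simp X) (w : simp X (i + j))).
  rewrite mu_pairing2_AW cup_chain_swapSHI addn0.
  exact: (prod_lift_cls (@cup_ddegen _ _ c _)).
rewrite [LHS]lift_gen_pi ?fglift1 //.
move=> g [w [k [l [y [lk Ey]]]]]; rewrite fglift1 E.
rewrite Ey.
exact: (@cup_ddegen X j c _ l (Tagged (simp X) y) (Tagged (simp X) y)).
Qed.

End Iterate.

(** * The bounds of summation *)

(** Up to the dimension d, the difference between the numbers of vertices of
    the two blocks: an alternating sum of the cut points. *)
Fixpoint skew (us : seq nat) : int :=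
  if us is u :: us' then 1 - u%:Z *+ 2 - skew us' else 1.

Lemma size_blocks d us : path gtn d.+1 us ->
  (size (blocks true d us))%:Z = (size (blocks false d us))%:Z + d%:Z + skew us.
Proof.
elim: us d => [|u us IH] d; first by rewrite size_iota /=; lia.
case/andP=> /= ud p; rewrite size_cat size_iota.
have := IH u (path_gtn_widen (leqnSn _) p); lia.
Qed.

Lemma skew_bounds u us : path gtn u us ->
  (size us)%:Z - u%:Z *+ 2 <= skew (u :: us) <= - (size us)%:Z.
Proof.
elim: us u => [|v us IH] u; first by rewrite /=; lia.
by case/andP=> vu /IH; move: vu; rewrite /=; move: (skew us); lia.
Qed.

Lemma S_bound_cons m k (v : int) (t : seq int) :
  S_bound m k (v :: t) = v - S_bound m k.+1 t + k%:Z.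
Proof.
rewrite /S_bound big_ord_recl /= expr0 mul1r.
under eq_bigr => r _ do rewrite exprS mulN1r mulNr.
rewrite sumrN exprS mulN1r mulNr.
have : (k./2 + (uphalf k) = k)%N by rewrite uphalf_half; lia.
by move: (\sum_(_ < _) _) (_ * _) => x y; lia.
Qed.

Lemma int_range_nat (a b : nat) : (a < b)%N ->
  int_range a (b%:Z - 1) = map Posz (iota a (b - a)).
Proof.
move=> ab; rewrite /int_range; have -> : (a%:Z <= b%:Z - 1) by lia.
have -> : (absz (b%:Z - 1 - a%:Z)%R).+1 = (b - a)%N by lia.
by have -> : iota a (b - a) = map (addn a) (iota 0 (b - a));
  [rewrite -iotaDl addn0 | rewrite -map_comp].
Qed.

(** The list t holds the indices already chosen, and the hypothesis on F says
    that its nonzero values only occur where the two faces have equal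
    dimension. Since an alternating sum of distinct cut points is controlled
    by the largest one ([skew_bounds]), this equation implies S(k) <= v for
    the next index v, so that starting the sum at S(k) loses nothing.
    Conversely v >= S(k) gives k - 1 <= S(k - 1) < v by [S_bound_cons], which
    keeps the range nonempty down to i_0 = S(0). *)
Lemma nested_sumE m k top (t : seq nat) (F : seq int -> 'F_2) :
  k%:Z <= S_bound m k (map Posz t) < top%:Z -> head m.+1 t = top ->
  (forall us, size us = k.+1 -> path gtn top us ->
     F (map Posz (catrev us t)) != 0 ->
     skew us = k%:Z - S_bound m k (map Posz t) *+ 2) ->
  nested_sum m k (map Posz t) F =
  sum_decr k.+1 top (fun us => F (map Posz (catrev us t))).
Proof.
elim: k top t => [|k IH] top t.
  rewrite [nested_sum _ _ _ _]/=.
  case: (S_bound _ _ _) => [s|s]; last by case/andP.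
  case/andP=> _ stop _ H; have s_top : (s < top)%N by lia.
  rewrite sum_decrS (bigD1 (Ordinal s_top)) //= big1 ?addr0 // => u nu.
  apply/eqP; apply: contraNT nu => /(H [:: (u : nat)] erefl) /=.
  rewrite ltn_ord => /(_ isT) E; apply/eqP/val_inj => /=; lia.
case E : (S_bound _ _ _) => [s|s]; last by case/andP.
case/andP=> ks stop ht H; have s_top : (s < top)%N by lia.
rewrite [nested_sum _ _ _ _]/= E.
have -> : head m.+1%:Z (map Posz t) = top%:Z by rewrite -ht; case: (t).
rewrite int_range_nat // big_map sum_decrS.
rewrite -(big_mkord xpredT (fun v => sum_decr k.+1 v (fun us =>
  F (map Posz (catrev (v :: us) t))))).
rewrite [RHS](big_cat_nat (n := s)) ?(ltnW s_top) //.
rewrite [X in _ = X + _]big_nat big1 ?add0r; last first.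
  move=> v vs; apply: (sum_decr0 (k := k.+1)) => us su p; apply/eqP.
  apply: contraT => /(H (v :: us)) /=; rewrite su p => /(_ erefl) E'.
  have := skew_bounds p; rewrite [skew _]/= su.
  by have := E' ltac:(lia); lia.
rewrite /index_iota; apply: eq_big_seq => v; rewrite mem_iota => vs.
have EV := S_bound_cons m k v (map Posz t); rewrite E in EV.
rewrite -[v%:Z :: _]/(map Posz (v :: t)); apply: (IH v (v :: t)) => //.
  by rewrite [map _ _]/= EV; lia.
move=> us su p nz; have := H (v :: us); rewrite /= su p => /(_ erefl).
by rewrite EV => /(_ ltac:(lia) nz); lia.
Qed.

Lemma blocks_sorted b d us : path gtn d.+1 us -> sorted ltn (blocks b d us).
Proof.
elim: us b d => [|u us IH] b d.
  by case: b => // _; apply: (iota_ltn_sorted 0 d.+1).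
case/andP=> /= ud p; have p' := path_gtn_widen (leqnSn u) p.
case: b; last exact: IH.
rewrite (sorted_pairwise ltn_trans) pairwise_cat -!(sorted_pairwise ltn_trans).
rewrite IH // iota_ltn_sorted !andbT; apply/allrelP=> x y.
rewrite mem_iota; case: us p p' {IH} => [|v us] // /andP[/= vu p] _.
by rewrite mem_blocks ?(path_gtn_widen _ p) // => /andP[]; lia.
Qed.

Lemma size_compl d v : sorted ltn v -> all (leq^~ d) v ->
  size (compl d v) = (d.+1 - size v)%N.
Proof.
move=> sv vd; rewrite size_filter.
rewrite -[X in (X - _)%N](size_iota 0) -(count_predC (mem v)).
suff -> : count (mem v) (iota 0 d.+1) = size v by rewrite addKn.
rewrite -size_filter; congr size.
apply: (irr_sorted_eq ltn_trans ltnn) => //.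
  by apply: sorted_filter (iota_ltn_sorted _ _); apply: ltn_trans.
move=> k; rewrite mem_filter mem_iota /=.
by case kv: (k \in v) => //=; have := allP vd k kv; rewrite /=; lia.
Qed.

(** * The strings of faces *)

Lemma nth_lt_countE (s : seq nat) k a : sorted ltn s -> (a < size s)%N ->
  (nth 0 s a < k)%N = (a < count (ltn^~ k) s)%N.
Proof.
elim: s a => //= x s IH a p; have sx := order_path_min ltn_trans p.
have c0 : (k <= x)%N -> count (ltn^~ k) s = 0%N.
  move=> kx; apply/eqP; rewrite -leqn0 leqNgt -has_count -all_predC.
  by apply: sub_all sx => y /=; lia.
case: a => [|a] /= az; first by case: ltnP => // /c0 ->.
have := IH a (path_sorted p) az; case: (ltnP x k) => xk; first by move->; lia.
by rewrite c0 // => ->; lia.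
Qed.

Section Strings.
Context (n k : nat) (s : seq nat).
Hypotheses (ss : sorted ltn s) (sz : size s = n.+1).

Let N := count (ltn^~ k) s.
Let N' := (N + (k \in s))%N.

Lemma nth_lt_count a : (a <= n)%N -> ((map Posz s)`_a < k%:Z) = (a < N)%N.
Proof.
move=> an; rewrite (nth_map 0%N) ?sz // ltz_nat.
by apply: nth_lt_countE; rewrite ?sz.
Qed.

Lemma lt_nth_count a : (a <= n)%N -> (k%:Z < (map Posz s)`_a) = (N' <= a)%N.
Proof.
move=> an; rewrite (nth_map 0%N) ?sz // ltz_nat ltnNge -ltnS.
rewrite nth_lt_countE ?sz //.
by rewrite count_ltS ?(sorted_uniq ltn_trans ltnn) // -leqNgt.
Qed.

(** Both conditions say that the number N of cut points below k is 2l + 1, and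
    that k is not a cut point itself; N' counts the cut points up to k. *)
Lemma has_between_fst h : (h.*2 <= n.+1)%N ->
  has (fun l => between (map Posz s) l.*2 l.*2.+1 k) (iota 0 h) =
  [&& k \notin s, odd N & N < h.*2]%N.
Proof.
move=> hn; transitivity
    (has (fun l => (l.*2 < N) && (N' <= l.*2.+1))%N (iota 0 h)).
  apply: eq_in_has => l; rewrite mem_iota /between => lh.
  by rewrite nth_lt_count ?lt_nth_count //; lia.
apply/hasP/and3P => [[l]|[ks oN Nh]].
  rewrite mem_iota /N'; case: (k \in s) => lh /=; first by lia.
  by move=> H; split=> //; lia.
exists (N./2); first by rewrite mem_iota; lia.
by rewrite /N' (negbTE ks); lia.
Qed.

(** Likewise with N = 2l, for l > 0. *)
Lemma has_between_snd h : (h.*2 <= n)%N ->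
  has (fun l => between (map Posz s) l.*2.-1 l.*2 k) (iota 1 h) =
  [&& k \notin s, ~~ odd N & 0 < N <= h.*2]%N.
Proof.
move=> hn; transitivity
    (has (fun l => (l.*2.-1 < N) && (N' <= l.*2))%N (iota 1 h)).
  apply: eq_in_has => l; rewrite mem_iota /between => lh.
  by rewrite nth_lt_count ?lt_nth_count //; lia.
apply/hasP/and3P => [[l]|[ks oN Nh]].
  rewrite mem_iota /N'; case: (k \in s) => lh /=; first by lia.
  by move=> H; split=> //; lia.
exists (N./2); first by rewrite mem_iota; lia.
by rewrite /N' (negbTE ks); lia.
Qed.

End Strings.

Section FaceStringFamilies.
Context (m n : nat) (us : seq nat).
Hypotheses (sz : size us = n.+1) (p : path gtn m.+1 us).

Let s := rev us.

Let ss : sorted ltn s.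
Proof. by rewrite rev_sorted; apply: path_sorted p. Qed.

Let ssz : size s = n.+1.
Proof. by rewrite size_rev. Qed.

Lemma notin_blocks b k : (k <= m)%N -> (k \notin blocks b m us) =
  (k \notin s) && (b != (odd (count (ltn^~ k) s) == odd n.+1)).
Proof. by move=> km; rewrite mem_blocks // km negb_or mem_rev count_rev sz. Qed.

Let count_bound k : (count (ltn^~ k) s + (k \in s) <= n.+1)%N.
Proof.
rewrite -count_ltS; first by rewrite -ssz count_size.
exact: (sorted_uniq ltn_trans ltnn ss).
Qed.

Lemma even_fst_compl : ~~ odd n ->
  even_fst m n (map Posz s) = compl m (blocks false m us).
Proof.
move=> en; apply: eq_in_filter => k; rewrite mem_iota => km.
rewrite notin_blocks; last by lia.
rewrite (has_between_fst _ ss ssz) ?(nth_lt_count _ ss ssz) //; last by lia.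
have := count_bound k; set N := count (ltn^~ k) s.
by case: (k \in s); rewrite /= ?addn0 ?addn1; lia.
Qed.

Lemma even_snd_compl : ~~ odd n ->
  even_snd m n (map Posz s) = compl m (blocks true m us).
Proof.
move=> en; apply: eq_in_filter => k; rewrite mem_iota => km.
rewrite notin_blocks; last by lia.
rewrite (has_between_snd _ ss ssz) ?(lt_nth_count _ ss ssz) //; last by lia.
have := count_bound k; set N := count (ltn^~ k) s.
by case: (k \in s); rewrite /= ?addn0 ?addn1; lia.
Qed.

Lemma odd_fst_compl : odd n ->
  odd_fst m n (map Posz s) = compl m (blocks true m us).
Proof.
move=> on; apply: eq_in_filter => k; rewrite mem_iota => km.
rewrite notin_blocks; last by lia.
rewrite (has_between_fst _ ss ssz) //; last by lia.
have := count_bound k; set N := count (ltn^~ k) s.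
by case: (k \in s); rewrite /= ?addn0 ?addn1; lia.
Qed.

Lemma odd_snd_compl : odd n ->
  odd_snd m n (map Posz s) = compl m (blocks false m us).
Proof.
move=> on; apply: eq_in_filter => k; rewrite mem_iota => km.
rewrite notin_blocks; last by lia.
rewrite (has_between_snd _ ss ssz) ?(lt_nth_count _ ss ssz) //; last by lia.
rewrite (nth_lt_count _ ss ssz) //.
have := count_bound k; set N := count (ltn^~ k) s.
by case: (k \in s); rewrite /= ?addn0 ?addn1; lia.
Qed.

End FaceStringFamilies.

Section Sum.
Context (X : sset) (i j : nat) (c : cochain X j) (y : simplex X).

Lemma face_val_neq0_size v : (0 < size v)%N -> all (leq^~ (tag y)) v ->
  face_val c y v != 0 -> size v = j.+1.
Proof.
move=> v0 vy; rewrite /face_val; case: ifP => sv; last by rewrite eqxx.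
rewrite /pair_faces /pairing; case: eqP => [e _|_]; last by rewrite eqxx.
move: e; rewrite tag_faces size_compl // => e.
suff : (size v <= (tag y).+1)%N by lia.
rewrite -[leqRHS](size_iota 0); apply: uniq_leq_size.
  exact: (sorted_uniq ltn_trans ltnn sv).
by move=> k /(allP vy); rewrite mem_iota /=; lia.
Qed.

Hypothesis ty : tag y = (i + j)%N.

Lemma face_val_blocks b us : path gtn (i + j).+1 us ->
  face_val c y (blocks b (i + j) us) =
  pair_faces c (compl (i + j) (blocks b (i + j) us)) y.
Proof. by move=> p; rewrite /face_val blocks_sorted // ty. Qed.

Hypothesis ij : (i <= j)%N.

(** A nonzero summand has two faces of dimension j, hence blocks of equal
    size, and [size_blocks] turns this into the equation required by
    [nested_sumE]. *)
Lemma nested_sum_cup (F : seq int -> 'F_2) :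
  (forall us, size us = (j - i).+1 -> path gtn (i + j).+1 us ->
     F (map Posz (rev us)) =
     face_val c y (blocks false (i + j) us) *
     face_val c y (blocks true (i + j) us)) ->
  nested_sum (i + j) (j - i) [::] F = cup c (j - i) y y.
Proof.
move=> FE; have S0 : S_bound (i + j) (j - i) (map Posz [::]) = j%:Z.
  by rewrite /S_bound big_ord0 /=; lia.
rewrite -[[::]]/(map Posz [::]) (nested_sumE (top := (i + j).+1)) //.
- by rewrite /cup ty; apply: eq_sum_decr => us su p; apply: FE.
- by rewrite S0; lia.
move=> us su p; rewrite S0 -[catrev _ _]/(rev us) FE // mulf_eq0 negb_or.
have f0 : (0 < size (blocks false (i + j) us))%N.
  case: (us) su p => //= u us' _ /andP[_ pu].
  by apply: blocks_size_gt0; apply: path_gtn_widen (leqnSn _) pu.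
have bd b : all (leq^~ (tag y)) (blocks b (i + j) us).
  by rewrite ty; apply: blocks_bound.
case/andP=> /(face_val_neq0_size f0 (bd _)) s1.
move=> /(face_val_neq0_size (blocks_size_gt0 p) (bd _)) s2.
by have := size_blocks p; rewrite s1 s2; lia.
Qed.

End Sum.

Theorem corollary3p2 (X : sset) (i j : nat) (c : cochain X j)
    (x : simp X (i + j)) :
  let n := (j - i)%N in
  let m := (i + j)%N in
  let y : simplex X := Tagged (simp X) x in
  [/\ (i <= j)%N -> ~~ odd (i + j) ->
        Sq c (cls x) =
        nested_sum m n [::] (fun I =>
          mu (tens (pair_faces c (even_fst m n I) y)
                   (pair_faces c (even_snd m n I) y))),
      (i <= j)%N -> odd (i + j) ->
        Sq c (cls x) =
        nested_sum m n [::] (fun I =>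
          mu (tens (pair_faces c (odd_fst m n I) y)
                   (pair_faces c (odd_snd m n I) y)))
    & (j < i)%N -> Sq c (cls x) = 0].
Proof.
move=> n m y; have ty : tag y = (i + j)%N by [].
split=> [ij par|ij par|ji].
- rewrite Sq_cup //; apply/esym/(nested_sum_cup ty ij) => us su p.
  have en : ~~ odd n by rewrite /n; lia.
  rewrite mu_tens even_fst_compl // even_snd_compl //.
  by rewrite -!(face_val_blocks c ty).
- rewrite Sq_cup //; apply/esym/(nested_sum_cup ty ij) => us su p.
  have on : odd n by rewrite /n; lia.
  rewrite mu_tens odd_fst_compl // odd_snd_compl // mulrC.
  by rewrite -!(face_val_blocks c ty).
by rewrite /Sq leqNgt ji.
Qed.
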